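(* Fix $\mathbf{x}=(x,X)$ with $x=(0,0)$ and $X=(1,0)$, and let $\mathcal B\subset T\mathbb R^2$ be the set of endpoints $\mathbf{y}=(y,Y)$ such that the space $\Gamma(\mathbf{x},\mathbf{y})$ of bounded curvature paths possesses a (non-empty) bounded isotopy class $\Delta(\mathbf{x},\mathbf{y})$. Then $\mathcal B\subset T\mathbb R^2$ is neither open nor closed.
   Context: **Space of endpoints.** Endpoints are pairs (point, unit tangent vector), so the space of endpoints, written $T\mathbb R^2$ in the claim, is the circle bundle $UT\mathbb R^2=\mathbb R^2\times\mathbb S^1$ over $\mathbb R^2$. The initial endpoint $\mathbf{x}$ is fixed, so a set of pairs $(\mathbf{x},\mathbf{y})$ is regarded as a set of final endpoints $\mathbf{y}$. **Bounded curvature paths.** For $\mathbf{x}=(x,X)$, $\mathbf{y}=(y,Y)$ with $x,y\in\mathbb R^2$ and unit tangent vectors $X,Y$, $\Gamma(\mathbf{x},\mathbf{y})$ is the set of paths $\gamma:[0,s]\to\mathbb R^2$ that are $C^1$ and piecewise $C^2$, parametrized by arc length, with $\gamma(0)=x$, $\gamma'(0)=X$, $\gamma(s)=y$, $\gamma'(s)=Y$, and $\|\gamma''(t)\|\le 1$ wherever defined (a path of length zero is allowed when $\mathbf{x}=\mathbf{y}$). It carries the topology of the $C^1$ metric; deformed paths are reparametrized by arc length, so their lengths may vary. Two paths are bounded-homotopic if they are joined by a continuous one-parameter family in $\Gamma(\mathbf{x},\mathbf{y})$, and bounded-isotopic if the family can be chosen to consist of embedded paths. A homotopy (isotopy) class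 is a maximal path connected set in $\Gamma(\mathbf{x},\mathbf{y})$. **Bounded isotopy classes.** A bounded isotopy class $\Delta(\mathbf{x},\mathbf{y})$ is a non-empty homotopy class of $\Gamma(\mathbf{x},\mathbf{y})$ consisting entirely of embedded paths, all having image in one common bounded region $\Omega\subset\mathbb R^2$. An isolated point of $\Gamma(\mathbf{x},\mathbf{y})$ (a path which is alone in its class, for instance an arc of a unit circle of length less than $\pi$) counts as a bounded isotopy class (with empty interior). *)

(* Defs.v *)
From HB Require Import structures.
From mathcomp Require Import all_boot all_order all_algebra.
From mathcomp Require Import all_classical all_reals all_analysis.

Set Implicit Arguments.
Unset Strict Implicit.
Unset Printing Implicit Defensive.

Import Order.TTheory GRing.Theory Num.Theory.
Import numFieldNormedType.Exports.

Local Open Scope classical_set_scope.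
Local Open Scope ring_scope.

(* The library norm on the product R * R is the max norm, hence a separate
   Euclidean norm; the topology and the bounded sets are the same. *)
Definition enorm (R : realType) (p : R * R) : R :=
  Num.sqrt (p.1 ^+ 2 + p.2 ^+ 2).

Definition circle (R : realType) : set (R * R) := [set v | enorm v = 1].

(* The circle bundle, with the product of the topology of the plane and the
   subset topology of the circle. *)
Definition UT (R : realType) : Type := ((R * R) * set_type (@circle R))%type.
HB.instance Definition _ (R : realType) :=
  Topological.copy (UT R) ((R * R) * set_type (@circle R))%type.

Definition base_point (R : realType) (y : UT R) : R * R := y.1.
Definition tangent (R : realType) (y : UT R) : R * R := set_val y.2.

Lemma circle_10 (R : realType) : ((1, 0) : R * R) \in @circle R.
Proof. by apply/mem_set; rewrite /circle /enorm /= expr1n expr0n addr0 sqrtr1. Qed.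

Definition origin_right (R : realType) : UT R :=
  ((0, 0), exist _ (1, 0) (circle_10 R)).

(* Only the restrictions of pos and vel to [0, len] are meaningful.  The tangent
   vel is carried as data so that a path of length zero has a tangent vector. *)
Record plane_path (R : realType) := PlanePath {
  len : R;
  pos : R -> R * R;
  vel : R -> R * R }.

(* Derivative relative to A: one-sided at the endpoints of an interval A.  It is
   a vacuous condition at an isolated point of A. *)
Definition has_deriv_within (R : realType) (A : set R) (f : R -> R * R) (t : R)
    (l : R * R) : Prop :=
  (u - t)^-1 *: (f u - f t) @[u --> within A (t^')] --> l.

Definition C1_path (R : realType) (g : plane_path R) : Prop :=
  (forall t, t \in `[0, len g] ->
     has_deriv_within `[0, len g] (pos g) t (vel g t)) /\
  {within `[0, len g], continuous (vel g)}.

Definition piecewise_C2 (R : realType) (g : plane_path R) : Prop :=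
  exists2 p : seq R, itv_partition 0 (len g) p &
    forall i, (i < size p)%N ->
      let a := nth 0 (0 :: p) i in
      let b := nth 0 p i in
      exists acc : R -> R * R,
        {within `[a, b], continuous acc} /\
        (forall t, t \in `[a, b] -> has_deriv_within `[a, b] (vel g) t (acc t)).

Definition Gamma (R : realType) (x y : UT R) : set (plane_path R) :=
  [set g | [/\ 0 <= len g, C1_path g & piecewise_C2 g] /\
    [/\ (forall t, t \in `[0, len g] -> enorm (vel g t) = 1),
        (pos g 0 = base_point x /\ vel g 0 = tangent x),
        (pos g (len g) = base_point y /\ vel g (len g) = tangent y) &
        (forall t, t \in `]0, len g[ -> derivable (vel g) t 1 ->
           enorm ('D_1 (vel g) t) <= 1)]].

(* Paths of different lengths are compared through their constant speed
   parametrizations u |-> pos g (len g * u) on [0, 1]. *)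
Definition sup_dist (R : realType) (f h : R -> R * R) : R :=
  sup [set enorm (f u - h u) | u in `[0, 1]].

Definition C1_dist (R : realType) (g h : plane_path R) : R :=
  sup_dist (fun u => pos g (len g * u)) (fun u => pos h (len h * u)) +
  sup_dist (fun u => len g *: vel g (len g * u))
           (fun u => len h *: vel h (len h * u)).

Definition C1_continuous (R : realType) (H : R -> plane_path R) : Prop :=
  forall t0, t0 \in `[0, 1] ->
    C1_dist (H t0) (H t) @[t --> within `[0, 1] (nbhs t0)] --> (0 : R).

Definition path_connected (R : realType) (S : set (plane_path R)) : Prop :=
  forall g h, S g -> S h ->
    exists H : R -> plane_path R,
      [/\ forall t, t \in `[0, 1] -> S (H t), C1_continuous H, H 0 = g & H 1 = h].

Definition homotopy_class (R : realType) (x y : UT R)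
    (D : set (plane_path R)) : Prop :=
  [/\ D `<=` Gamma x y, path_connected D &
      forall S, S `<=` Gamma x y -> path_connected S -> D `<=` S -> S `<=` D].

Definition embedded (R : realType) (g : plane_path R) : Prop :=
  {in `[0, len g] &, injective (pos g)}.

Definition image_in (R : realType) (g : plane_path R) (Omega : set (R * R)) :
    Prop :=
  forall t, t \in `[0, len g] -> Omega (pos g t).

Definition same_path (R : realType) (g h : plane_path R) : Prop :=
  len g = len h /\ {in `[0, len g], pos g =1 pos h}.

Definition bounded_isotopy_class (R : realType) (x y : UT R)
    (D : set (plane_path R)) : Prop :=
  [/\ D !=set0, homotopy_class x y D &
    ((forall g, D g -> embedded g) /\
     (exists2 Omega : set (R * R), bounded_set Omega &
        forall g, D g -> image_in g Omega))
    (* a class reduced to a single path *)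
    \/ (forall g h, D g -> D h -> same_path g h)].

Definition bounded_class_endpoints (R : realType) : set (UT R) :=
  [set y | exists D, bounded_isotopy_class (origin_right R) y D].

(* Main.v *)
(* A path g of a class D having velocities v(t') = - v(t) at times t <= t' can be
   stretched: inserting straight segments of the same length s at t and at t'
   moves neither endpoint, so D contains paths of all lengths >= len g.

   Not open: the path of length 0 is alone in its class, because shorter than pi
   there is no other path with the same endpoints.  Rotate the final tangent
   vector slightly, keeping the final point at the origin: all paths are then
   closed, hence not embedded, and a closed path has antipodal velocities, hence
   is not alone in its class.

   Not closed: for t < pi the endpoint of the unit arc of length t has the arc as
   its only path of length < pi, so lengths along a homotopy, which vary
   continuously, cannot leave t and the arc is alone in its class.  When t tends
   to pi the initial and final velocities become antipodal, and every class
   contains unboundedly far stretched paths.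

   The uniqueness of the arc is a Schur comparison: the velocity turns at speed at
   most 1, so v(s) . v(m) >= cos (s - m); taking for m a time at which v(m) is the
   direction of the chord, the chord has length at least sin m + sin (len - m). *)
Require Import Defs.
From mathcomp Require Import all_boot all_order all_algebra.
From mathcomp Require Import all_classical all_reals all_analysis.
From mathcomp Require Import ring lra.

Set Implicit Arguments.
Unset Strict Implicit.
Unset Printing Implicit Defensive.

Import Order.TTheory GRing.Theory Num.Theory.
Import numFieldNormedType.Exports.

Local Open Scope classical_set_scope.
Local Open Scope ring_scope.

(** * Plane vectors and derivatives relative to a set *)

Section plane.
Variable R : realType.
Implicit Types (p q w : R * R) (A B : set R) (f v : R -> R * R).

Definition dot w p : R := w.1 * p.1 + w.2 * p.2.

Lemma enorm_ge0 p : 0 <= enorm p.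
Proof. exact: sqrtr_ge0. Qed.

Lemma enorm_sqr p : enorm p ^+ 2 = dot p p.
Proof. by rewrite sqr_sqrtr ?addr_ge0 ?sqr_ge0// /dot !expr2. Qed.

Lemma dot_le_enorm w p : dot w p <= enorm w * enorm p.
Proof.
rewrite -sqrtrM ?addr_ge0 ?sqr_ge0//.
apply: (le_trans (ler_norm _)); rewrite -sqrtr_sqr ler_sqrt; last first.
  by rewrite mulr_ge0 ?addr_ge0 ?sqr_ge0.
rewrite -subr_ge0 (_ : _ - _ = (w.1 * p.2 - w.2 * p.1) ^+ 2) ?sqr_ge0//.
rewrite /dot; ring.
Qed.

Lemma enormZ (k : R) p : enorm (k *: p) = `|k| * enorm p.
Proof.
rewrite /enorm /= -sqrtr_sqr -sqrtrM ?sqr_ge0//; congr Num.sqrt.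
by rewrite /GRing.scale/=; ring.
Qed.

Lemma enormN p : enorm (- p) = enorm p.
Proof. by rewrite -scaleN1r enormZ normrN1 mul1r. Qed.

Lemma enormB p q : enorm (p - q) = enorm (q - p).
Proof. by rewrite -enormN opprB. Qed.

(** Testing with [w := p] gives the bound. It reduces estimates on vector valued functions to
    estimates on the scalar functions [dot w \o f]. *)
Lemma enorm_le_dot (k : R) p :
  0 <= k -> (forall w, dot w p <= enorm w * k) -> enorm p <= k.
Proof.
move=> k0 /(_ p); rewrite -enorm_sqr expr2.
have := enorm_ge0 p; rewrite le_eqVlt => /orP[/eqP <-//|p0].
by rewrite ler_pM2l.
Qed.

Lemma dotDr w p q : dot w (p + q) = dot w p + dot w q.
Proof. by rewrite /dot /=; ring. Qed.

Lemma dotNr w p : dot w (- p) = - dot w p.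
Proof. by rewrite /dot /=; ring. Qed.

Lemma dotZr (k : R) w p : dot w (k *: p) = k * dot w p.
Proof. by rewrite /dot /= /GRing.scale /=; ring. Qed.

Lemma ler_enormD p q : enorm (p + q) <= enorm p + enorm q.
Proof.
apply: enorm_le_dot => [|w]; first by rewrite addr_ge0 ?enorm_ge0.
by rewrite dotDr mulrDr lerD ?dot_le_enorm.
Qed.

Lemma enorm0_eq0 p : enorm p = 0 -> p = 0.
Proof.
move=> p0; have := enorm_sqr p; rewrite p0 expr0n /dot/= -!expr2 => /esym/eqP.
rewrite paddr_eq0 ?sqr_ge0// !sqrf_eq0; case: p {p0} => a b /=.
by move=> /andP[/eqP -> /eqP ->].
Qed.

Lemma norm_le_enorm p : `|p| <= enorm p.
Proof.
rewrite prod_normE ge_max.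
by apply/andP; split; rewrite -sqrtr_sqr ler_sqrt ?addr_ge0 ?sqr_ge0//
  ?lerDl ?lerDr sqr_ge0.
Qed.

Lemma has_deriv_withinP A f t l : has_deriv_within A f t l <->
  forall e : R, 0 < e -> exists2 d : R, 0 < d & forall u, A u -> u != t ->
    `|u - t| < d -> `|(u - t)^-1 *: (f u - f t) - l| < e.
Proof.
split=> [/cvgrPdist_lt H e e0|H].
  have := H e e0; rewrite !near_withinE => /nbhs_ballP[d/= d0 dH].
  exists d => // u Au ut utd; rewrite distrC; apply: (dH u) => //.
  by rewrite /ball/= distrC.
apply/cvgrPdist_lt => e e0; have [d d0 dH] := H e e0.
rewrite !near_withinE; apply/nbhs_ballP; exists d => // u ud ut Au.
by rewrite distrC; apply: dH => //; rewrite distrC.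
Qed.

Lemma within_continuousP (V : normedModType R) A (f : R -> V) :
  {within A, continuous f} <->
  forall t, A t -> forall e : R, 0 < e -> exists2 d : R, 0 < d & forall u, A u ->
    `|u - t| < d -> `|f u - f t| < e.
Proof.
split=> [H t At e e0|H].
  have /cvgrPdist_lt /(_ e e0) := H t.
  rewrite /prop_near1 /nbhs /= -nbhs_subspace_in// => /nbhs_ballP[d/= d0 dH].
  by exists d => // u Au utd; rewrite distrC; apply: dH => //; rewrite /ball/= distrC.
apply/subspace_continuousP => t At; apply/cvgrPdist_lt => e e0.
have [d d0 dH] := H t At e e0.
rewrite near_withinE; apply/nbhs_ballP; exists d => // u /= ud Au.
by rewrite distrC; apply: dH => //; rewrite distrC.
Qed.

Lemma has_deriv_withinW A B f t l :
  A `<=` B -> has_deriv_within B f t l -> has_deriv_within A f t l.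
Proof.
move=> AB /has_deriv_withinP H; apply/has_deriv_withinP => e /H[d d0 dH].
by exists d => // u /AB; exact: dH.
Qed.

Lemma has_deriv_within_glue A B f t l :
  has_deriv_within A f t l -> has_deriv_within B f t l ->
  has_deriv_within (A `|` B) f t l.
Proof.
move=> /has_deriv_withinP HA /has_deriv_withinP HB; apply/has_deriv_withinP.
move=> e e0; have [d d0 dH] := HA e e0; have [d' d'0 d'H] := HB e e0.
exists (Num.min d d') => [|u]; first by rewrite lt_min d0 d'0.
by rewrite lt_min => -[Au|Bu] ut /andP[ud ud']; [exact: dH|exact: d'H].
Qed.

Lemma has_deriv_within_eq A f g t l : A t -> {in A, f =1 g} ->
  has_deriv_within A f t l -> has_deriv_within A g t l.
Proof.
move=> At fg /has_deriv_withinP H; apply/has_deriv_withinP => e /H[d d0 dH].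
by exists d => // u Au; rewrite -!fg ?inE//; exact: dH.
Qed.

Lemma has_deriv_within_shift A f t l (s : R) q :
  has_deriv_within A f t l ->
  has_deriv_within [set u | A (u - s)]
    (fun u => f (u - s) + q) (t + s) l.
Proof.
move=> /has_deriv_withinP H; apply/has_deriv_withinP => e /H[d d0 dH].
exists d => // u Au ut ud; have -> : f (u - s) + q - (f (t + s - s) + q) =
   f (u - s) - f t by rewrite addrK opprD addrACA subrr addr0.
rewrite (_ : u - (t + s) = u - s - t); last by ring.
apply: dH => //; first by rewrite subr_eq.
by rewrite (_ : u - s - t = u - (t + s))//; ring.
Qed.

(** No difference quotient is taken near [t]. This disposes of the pieces that do not reach [t] when
    derivatives are glued. *)
Lemma has_deriv_within_sep A f t l (d : R) : 0 < d ->
  (forall u, A u -> d <= `|u - t|) -> has_deriv_within A f t l.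
Proof.
move=> d0 H; apply/has_deriv_withinP => e e0; exists d => // u /H.
by rewrite leNgt => /negP dut _ /dut.
Qed.

Lemma has_deriv_within_itv (a b : R) f (t : R) l :
  t \in `]a, b[ -> has_deriv_within `[a, b] f t l -> is_derive t (1 : R) f l.
Proof.
move=> tab /has_deriv_withinP H.
suff C : (fun h => h^-1 *: ((f \o shift t) (h *: (1 : R)) - f t)) @ 0^' --> l.
  by split; [apply/cvg_ex; exists l | exact/cvg_lim].
apply/cvgrPdist_lt => e e0; have [d d0 dH] := H e e0.
rewrite near_withinE; apply/nbhs_ballP; move: tab; rewrite in_itv/= => /andP[at_ tb].
exists (Num.min d (Num.min (t - a) (b - t))) => /=.
  by rewrite !lt_min d0 !subr_gt0 at_ tb.
move=> h; rewrite /ball/= sub0r normrN !lt_min => /and3P[hd hta hbt] h0.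
have := dH (h + t); rewrite addrK distrC /shift/= /GRing.scale/= mulr1; apply => //.
- rewrite /= in_itv/=; move: hta hbt; rewrite !ltr_norml; lra.
- by rewrite -subr_eq0 addrK.
Qed.

Lemma is_derive_has_deriv_within A f (t : R) l :
  is_derive t (1 : R) f l -> has_deriv_within A f t l.
Proof.
move=> fl; apply/has_deriv_withinP => e e0.
have := @ex_derive _ _ _ _ _ _ _ fl; have := @derive_val _ _ _ _ _ _ _ fl.
rewrite /derive /derivable => <- /cvgrPdist_lt /(_ e e0).
rewrite near_withinE => /nbhs_ballP[d/= d0 dH]; exists d => // u Au ut utd.
have := dH (u - t); rewrite /ball/= sub0r normrN => /(_ utd).
rewrite subr_eq0 => /(_ ut); rewrite /shift/= /GRing.scale/= mulr1 subrK distrC.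
exact.
Qed.

Lemma is_derive_dot w f (t : R) l :
  is_derive t (1 : R) f l -> is_derive t 1 (fun u => dot w (f u)) (dot w l).
Proof.
move=> fl.
suff C : (fun h => h^-1 *: (((fun u => dot w (f u)) \o shift t) (h *: (1 : R)) -
    dot w (f t))) @ 0^' --> dot w l.
  by split; [apply/cvg_ex; exists (dot w l) | exact/cvg_lim].
have := @ex_derive _ _ _ _ _ _ _ fl; have := @derive_val _ _ _ _ _ _ _ fl.
rewrite /derive /derivable => ell cl.
have {}cl : (fun h => h^-1 *: ((f \o shift t) (h *: (1 : R)) - f t)) @ 0^' --> l.
  by rewrite -ell.
have -> : (fun h => h^-1 *: (((fun u => dot w (f u)) \o shift t) (h *: (1 : R)) -
    dot w (f t))) = dot w \o (fun h => h^-1 *: ((f \o shift t) (h *: (1 : R)) - f t)).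
  by apply/funext => h /=; rewrite dotZr dotDr dotNr.
apply: cvg_comp cl _; rewrite /dot.
apply: cvgD; apply: cvgM; [exact: cvg_cst|exact: cvg_fst|exact: cvg_cst|exact: cvg_snd].
Qed.

Lemma dot_continuous w : continuous (dot w).
Proof.
move=> p; rewrite /dot /continuous_at.
apply: cvgD; apply: cvgM; [exact: cvg_cst|exact: cvg_fst|exact: cvg_cst|exact: cvg_snd].
Qed.

End plane.

(** * Piecewise regularity *)

Section piecewise.
Variable R : realType.
Implicit Types (f v : R -> R * R) (P Q : R -> R -> Prop) (g : plane_path R).

(** Split the interval at each exceptional point inside it; without such points, apply the mean
    value theorem. The finite set accounts for the break points of piecewise C2 paths. *)
Lemma nondecreasing_off_finite (s : seq R) (F : R -> R) (a b : R) : a <= b ->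
  {within `[a, b], continuous F} ->
  (forall t, t \in `]a, b[ -> t \notin s ->
     exists2 l, is_derive t (1 : R) F l & 0 <= l) ->
  F a <= F b.
Proof.
elim: s a b => [|c s IH] a b ab cF dF.
  have [->//|ab'] := eqVneq a b; have {ab ab'} ab : a < b by rewrite lt_neqAle ab'.
  have dF' x : x \in `]a, b[%R -> is_derive x 1 F ('D_1 F x).
    by move=> /dF/(_ isT)[l [dFx _] _]; exact: (DeriveDef dFx).
  have [x xab Fab] := MVT ab dF' cF.
  have [l lx l0] := dF x xab isT.
  by rewrite -subr_ge0 Fab (derive_val (is_derive := lx)) mulr_ge0// subr_ge0 ltW.
have [cab|cab] := boolP (c \in `]a, b[).
  move: (cab); rewrite in_itv/= => /andP[ac cb].
  have Hl : F a <= F c.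
    apply: IH (ltW ac) _ _.
      by apply: continuous_subspaceW cF; apply: subset_itvl; rewrite bnd_simp ltW.
    move=> t; rewrite in_itv/= => /andP[at_ tc] ts; apply: dF.
      by rewrite in_itv/= at_ (lt_trans tc).
    by rewrite inE negb_or ts lt_eqF.
  apply: (le_trans Hl); apply: IH (ltW cb) _ _.
    by apply: continuous_subspaceW cF; apply: subset_itvr; rewrite bnd_simp ltW.
  move=> t; rewrite in_itv/= => /andP[ct tb] ts; apply: dF.
    by rewrite in_itv/= tb andbT (lt_trans ac).
  by rewrite inE negb_or ts gt_eqF.
apply: IH => // t tab ts; apply: dF => //.
by rewrite inE negb_or ts andbT; apply: contraNneq cab => <-.
Qed.

Lemma has_deriv_within_continuous (A : set R) f t l :
  has_deriv_within A f t l ->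
  forall e : R, 0 < e -> exists2 d : R, 0 < d & forall u, A u ->
    `|u - t| < d -> `|f u - f t| < e.
Proof.
move=> /has_deriv_withinP /(_ 1 ltr01)[d d0 dH] e e0.
have k0 : 0 < `|l| + 1 by rewrite ltr_wpDl.
exists (Num.min d (e / (`|l| + 1))) => [|u Au].
  by rewrite lt_min d0 divr_gt0.
have [->|ut] := eqVneq u t; first by rewrite [f t - _]subrr normr0.
rewrite lt_min => /andP[/(dH u Au ut) q ue].
have q' : `|(u - t)^-1 *: (f u - f t)| < `|l| + 1.
  rewrite -[X in `|X|](subrK l) addrC; apply: le_lt_trans (ler_normD _ _) _.
  by rewrite ltrD2l.
have ut0 : 0 < `|u - t| by rewrite normr_gt0 subr_eq0.
move: q'; rewrite normrZ normfV mulrC ltr_pdivrMr// => /lt_trans; apply.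
by rewrite mulrC -ltr_pdivlMr.
Qed.

(** An inductive form of interval partitions, so that pieces can be cut, joined and shifted by
    induction. All pieces have positive length. *)
Inductive piecewise P : R -> R -> Prop :=
| piecewise_nil a : piecewise P a a
| piecewise_cons a b c : a < b -> P a b -> piecewise P b c -> piecewise P a c.

Definition C2_on v (a b : R) : Prop := exists acc : R -> R * R,
  {within `[a, b], continuous acc} /\
  (forall t, t \in `[a, b] -> has_deriv_within `[a, b] v t (acc t)).

Lemma piecewise_C2P g :
  piecewise_C2 g <-> piecewise (C2_on (vel g)) 0 (len g).
Proof.
have seqP P b p : forall a, itv_partition a b p ->
    (forall i, (i < size p)%N -> P (nth 0 (a :: p) i) (nth 0 p i)) ->
    piecewise P a b.
  elim: p => [|c p IH] a.
    by move=> /itv_partition_nil -> _; exact: piecewise_nil.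
  move=> ap H; apply: (piecewise_cons (b := c)).
  - by case: ap => /andP[].
  - exact: (H 0%N).
  - by apply: IH => [|i ip]; [exact: itv_partition_cons ap|exact: (H i.+1 ip)].
split=> [[p gp H]|]; first exact: seqP gp H.
suff pwP P a b : piecewise P a b -> exists2 p, itv_partition a b p &
    forall i, (i < size p)%N -> P (nth 0 (a :: p) i) (nth 0 p i).
  by move=> /pwP[p gp H]; exists p.
elim=> {a b} [a|a b c ab Pab _ [p [bp /eqP pc] H]].
  by exists [::] => //; split.
exists (b :: p); first by split; rewrite /= ?ab//; apply/eqP.
by move=> [|i] ip //; exact: H.
Qed.

Lemma piecewise_le P a b : piecewise P a b -> a <= b.
Proof. by elim=> // {}a {}b c ab _ _ /(lt_le_trans ab)/ltW. Qed.

Lemma piecewise_cat P a b c : piecewise P a b -> piecewise P b c -> piecewise P a c.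
Proof.
by elim=> // {}a {}b d ab Pab _ IH /IH; exact: piecewise_cons.
Qed.

Lemma piecewise_sub P Q a b :
  (forall c d, a <= c -> c < d -> d <= b -> P c d -> Q c d) ->
  piecewise P a b -> piecewise Q a b.
Proof.
move=> PQ Pab; elim: Pab PQ => [c|{}a c {}b ac Pac Pcb IH] PQ.
  exact: piecewise_nil.
have cb := piecewise_le Pcb.
apply: (piecewise_cons (b := c)) => //; first exact: PQ.
by apply: IH => x y cx xy yb; apply: PQ => //; rewrite (le_trans (ltW ac)).
Qed.

Lemma piecewise_split P a b c :
  (forall x y x' y', P x y -> x <= x' -> x' < y' -> y' <= y -> P x' y') ->
  piecewise P a c -> a <= b -> b <= c -> piecewise P a b /\ piecewise P b c.
Proof.
move=> Pm; elim=> {a c} [a ab ba|a d c ad Pad Pdc IH ab bc].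
  by have -> : b = a by [apply/eqP; rewrite eq_le ab ba]; split; exact: piecewise_nil.
have [db|bd] := leP d b.
  have [Pdb Pbc] := IH db bc; split => //; exact: piecewise_cons Pdb.
split.
  have [->|nab] := eqVneq a b; first exact: piecewise_nil.
  have {}ab : a < b by rewrite lt_neqAle nab.
  apply: (piecewise_cons ab); last exact: piecewise_nil.
  by apply: Pm Pad _ _ _ => //; exact: ltW.
apply: (piecewise_cons bd) => //.
by apply: Pm Pad _ _ _.
Qed.

Lemma piecewise_shift P Q (s : R) a b :
  (forall c d, P c d -> Q (c + s) (d + s)) ->
  piecewise P a b -> piecewise Q (a + s) (b + s).
Proof.
move=> PQ; elim=> {a b} [a|a b c ab Pab _ IH]; first exact: piecewise_nil.
by apply: piecewise_cons IH; [rewrite ltrD2r|exact: PQ].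
Qed.

Lemma piecewise_itv P a b : piecewise P a b -> exists s : seq R,
  forall t, t \in `]a, b[ -> t \notin s -> exists c d,
    [/\ a <= c, d <= b, t \in `]c, d[ & P c d].
Proof.
elim=> {a b} [a|a b c ab Pab Pbc [s sP]].
  by exists [::] => t; rewrite in_itv/= => tab; move: (lt_asym a t); rewrite tab.
have bc := piecewise_le Pbc.
exists (b :: s) => t; rewrite in_itv/= => /andP[at_ tc].
rewrite inE negb_or => /andP[tb ts].
have [{}tb|bt|/eqP] := ltgtP t b; last by rewrite (negPf tb).
  by exists a, b; split => //; rewrite in_itv/= at_ tb.
have [|x [y [bx yc txy Pxy]]] := sP t _ ts; first by rewrite in_itv/= bt tc.
by exists x, y; split => //; apply: le_trans bx; exact: ltW.
Qed.

Lemma C2_onW v a b c d : C2_on v a b -> a <= c -> d <= b -> C2_on v c d.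
Proof.
move=> [acc [cacc dacc]] ac db.
have sub : `[c, d] `<=` `[a, b].
  by move=> t /=; rewrite !in_itv/= => /andP[/(le_trans ac) -> /le_trans ->].
exists acc; split=> [|t tcd]; first exact: continuous_subspaceW cacc.
exact: has_deriv_withinW (dacc _ (sub _ tcd)).
Qed.

Lemma C2_on_eq v w a b : {in `[a, b], v =1 w} -> C2_on v a b -> C2_on w a b.
Proof.
move=> vw [acc [cacc dacc]]; exists acc; split => // t tab.
apply: has_deriv_within_eq (dacc t tab) => //.
by move=> u; rewrite inE; exact: vw.
Qed.

Lemma C2_on_shift v w a b (s : R) :
  {in `[a, b], forall u, w (u + s) = v u} ->
  C2_on v a b -> C2_on w (a + s) (b + s).
Proof.
have E u : (u - s \in `[a, b]) = (u \in `[a + s, b + s]).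
  by rewrite !in_itv/= lerBrDr lerBlDr.
move=> vw [acc [cacc dacc]]; exists (fun u => acc (u - s)); split => [|t].
  apply/within_continuousP => t /=; rewrite -E => ts e e0.
  have /within_continuousP /(_ _ ts e e0)[d d0 dH] := cacc.
  exists d => // u; rewrite -E => us utd; apply: dH => //.
  by rewrite opprB addrA subrK.
rewrite -E => ts; have := has_deriv_within_shift s 0 (dacc _ ts).
have -> : [set u | `[a, b]%classic (u - s)] = `[a + s, b + s]%classic.
  by apply/seteqP; split => u /=; rewrite E.
rewrite subrK; apply: has_deriv_within_eq; first by rewrite /= -E.
by move=> u; rewrite inE/= -E => us; rewrite addr0 -vw// subrK.
Qed.

End piecewise.

(** * Lipschitz bounds and turning angle *)

Section curvature.
Variable R : realType.
Implicit Types (w : R * R) (g : plane_path R) (y : UT R).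

(** The conditions of [Gamma] that do not mention endpoints: inserting a single segment preserves
    them although it may move the final point. *)
Definition bounded_curvature g : Prop :=
  [/\ 0 <= len g, C1_path g, piecewise_C2 g,
    (forall t, t \in `[0, len g] -> enorm (vel g t) = 1) &
    (forall t, t \in `]0, len g[ -> derivable (vel g) t 1 ->
       enorm ('D_1 (vel g) t) <= 1)].

Lemma GammaP x y g : Gamma x y g <-> bounded_curvature g /\
  [/\ pos g 0 = base_point x, vel g 0 = tangent x,
      pos g (len g) = base_point y & vel g (len g) = tangent y].
Proof.
split=> [[[? ? ?] [? [? ?] [? ?] ?]]|[[? ? ? ? ?] [? ? ? ?]]].
  by split; split.
by split; split=> //; split.
Qed.

Lemma C1_pos_derive g t : C1_path g -> t \in `]0, len g[ ->
  is_derive t (1 : R) (pos g) (vel g t).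
Proof.
move=> [dpos _] tI; apply: (has_deriv_within_itv tI).
by apply: dpos; exact: subset_itv_oo_cc.
Qed.

Lemma C1_pos_continuous g : C1_path g -> {within `[0, len g], continuous (pos g)}.
Proof.
move=> [dpos _]; apply/within_continuousP => t tI.
exact: has_deriv_within_continuous (dpos t tI).
Qed.

Lemma within_dot w (A : set R) (f : R -> R * R) :
  {within A, continuous f} -> {within A, continuous (fun u => dot w (f u))}.
Proof.
move=> cf u; apply: (@continuous_comp (subspace A) _ _ f (dot w) u (cf u)).
exact: dot_continuous.
Qed.

Lemma vel_derive g : bounded_curvature g -> exists s : seq R,
  forall t, t \in `]0, len g[ -> t \notin s -> exists a,
    [/\ is_derive t (1 : R) (vel g) a, enorm a <= 1 & dot (vel g t) a = 0].
Proof.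
move=> [g0 C1 /piecewise_C2P/piecewise_itv[s sP] unit curv].
exists s => t tI ts; have [c [d [c0 dg tcd [acc [_ dacc]]]]] := sP t tI ts.
have dcd u : u \in `]c, d[ -> is_derive u (1 : R) (vel g) (acc u).
  by move=> ucd; apply: (has_deriv_within_itv ucd); apply: dacc; exact: subset_itv_oo_cc.
have dt := dcd t tcd; exists (acc t); split => //.
  case: (dt) => + <-; apply: curv => //.
have max0 : is_derive t (1 : R) (fun u => dot (vel g t) (vel g u)) 0.
  apply: (derive1_at_max (a := c) (b := d)) => //.
  - by move: tcd; rewrite in_itv/= => /andP[/lt_trans h /h /ltW].
  - move=> u /dcd du.
    by case: (is_derive_dot (vel g t) du).
  - move=> u; rewrite -[dot _ (vel g t)]enorm_sqr unit ?subset_itv_oo_cc//.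
    rewrite in_itv/= => /andP[cu ud]; apply: le_trans (dot_le_enorm _ _) _.
    rewrite unit ?subset_itv_oo_cc// unit ?expr1n ?mulr1// in_itv/=.
    by rewrite (le_trans c0 (ltW cu)) (le_trans (ltW ud) dg).
by case: (is_derive_dot (vel g t) dt) => _ <-; case: max0.
Qed.

(** For each [w], the function [enorm w * r - dot w (f r)] of [r] is nondecreasing; [enorm_le_dot]
    then recovers the norm. *)
Lemma lipschitz_off_finite (s : seq R) (f : R -> R * R) (l : R) :
  {within `[0, l], continuous f} ->
  (forall t, t \in `]0, l[ -> t \notin s ->
     exists2 a, is_derive t (1 : R) f a & enorm a <= 1) ->
  {in `[0, l] &, forall t u, enorm (f t - f u) <= `|t - u|}.
Proof.
move=> cf df.
have lip : {in `[0, l] &, forall u t, u <= t -> enorm (f t - f u) <= t - u}.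
  move=> u t /=; rewrite !in_itv/= => /andP[u0 ul] /andP[t0 tl] ut.
  apply: enorm_le_dot => [|w]; first by rewrite subr_ge0.
  rewrite dotDr dotNr -subr_ge0.
  have H := @nondecreasing_off_finite R s
    (fun r => enorm w * r - dot w (f r)) u t ut.
  rewrite (_ : _ - _ = enorm w * t - dot w (f t) -
    (enorm w * u - dot w (f u))); last by ring.
  rewrite subr_ge0; apply: H => [|r rut rs].
    have sub : `[u, t] `<=` `[0, l] by apply: subset_itv; rewrite bnd_simp.
    move=> r; apply: cvgB.
      by apply: continuous_subspaceT => ?; exact: mulrl_continuous.
    exact: (continuous_subspaceW sub (within_dot (w := w) cf)).
  have rI : r \in `]0, l[.
    move: rut; rewrite !in_itv/= => /andP[ur rt].
    by rewrite (le_lt_trans u0 ur) (lt_le_trans rt tl).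
  have [a da a1] := df r rI rs.
  exists (enorm w * 1 - dot w a).
    have daw := is_derive_dot w da.
    by apply: is_deriveB.
  rewrite mulr1 subr_ge0; apply: le_trans (dot_le_enorm _ _) _.
  by rewrite ler_piMr ?enorm_ge0.
move=> u t uI tI; have [ut|tu] := leP u t.
  by rewrite enormB distrC (le_trans (lip _ _ uI tI ut)) ?ler_norm.
by rewrite (le_trans (lip _ _ tI uI (ltW tu))) ?ler_norm.
Qed.

Lemma vel_lipschitz g : bounded_curvature g ->
  {in `[0, len g] &, forall s t, enorm (vel g s - vel g t) <= `|s - t|}.
Proof.
move=> bg; have [_ [_ cvel] _ _ _] := bg; have [s sP] := vel_derive bg.
apply: (lipschitz_off_finite (s := s)) => // t tI /(sP t tI)[a [? ? _]].
by exists a.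
Qed.

Lemma pos_lipschitz g : bounded_curvature g ->
  {in `[0, len g] &, forall s t, enorm (pos g s - pos g t) <= `|s - t|}.
Proof.
move=> [_ C1 _ unit _]; apply: (lipschitz_off_finite (s := [::])).
  exact: C1_pos_continuous.
move=> t tI _; exists (vel g t); first exact: C1_pos_derive.
by rewrite unit// subset_itv_oo_cc.
Qed.

End curvature.

(** * Angle comparison with the unit circle *)

Section angle.
Variable R : realType.
Implicit Types (w : R * R) (g : plane_path R).

Lemma ler_norm_dot w p : `|dot w p| <= enorm w * enorm p.
Proof.
rewrite ler_norml dot_le_enorm andbT -lerN2 opprK -dotNr.
by rewrite (le_trans (dot_le_enorm _ _))// enormN.
Qed.

(** In the plane [a] is [k] times [v] turned by a right angle, with [k] the determinant of [v] and
    [a]. The component of [w] along the turned vector has square [1 - dot w v ^+ 2], and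
    [k ^+ 2 <= 1]. *)
Lemma sqr_dot_orthogonal (v w a : R * R) : enorm v = 1 -> enorm w = 1 ->
  enorm a <= 1 -> dot v a = 0 -> dot w a ^+ 2 <= 1 - dot w v ^+ 2.
Proof.
move=> v1 w1 a1 va.
have vv : dot v v = 1 by rewrite -enorm_sqr v1 expr1n.
have ww : dot w w = 1 by rewrite -enorm_sqr w1 expr1n.
have aa : dot a a <= 1 by rewrite -enorm_sqr expr_le1// enorm_ge0.
pose k := v.1 * a.2 - v.2 * a.1.
have kk : k ^+ 2 = dot a a.
  transitivity (dot v v * dot a a - dot v a ^+ 2); last by rewrite vv va; ring.
  by rewrite /k /dot; ring.
have -> : dot w a ^+ 2 = k ^+ 2 * (1 - dot w v ^+ 2).
  transitivity ((dot v v * dot w a - dot v a * dot w v) ^+ 2).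
    by rewrite vv va; ring.
  transitivity (k ^+ 2 * (dot w w * dot v v - dot w v ^+ 2)).
    by rewrite /k /dot; ring.
  by rewrite ww vv mulr1.
rewrite kk ler_piMl// subr_ge0 -real_normK ?num_real// expr_le1//.
by rewrite (le_trans (ler_norm_dot _ _))// w1 v1 mulr1.
Qed.

(* The factor k < 1 keeps the argument of acos inside ]-1, 1[, where acos is
   differentiable. *)
Lemma acos_dot_vel_lipschitz w g (k s t : R) : bounded_curvature g ->
  enorm w = 1 -> 0 < k < 1 -> 0 <= s -> s <= t -> t <= len g ->
  `|acos (k * dot w (vel g t)) - acos (k * dot w (vel g s))| <= t - s.
Proof.
move=> bg w1 /andP[k0 k1] s0 st tg.
have [_ C1 _ unit _] := bg; have [e eP] := vel_derive bg.
pose p u := k * dot w (vel g u); pose G := @acos R \o p.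
have sub : `[s, t] `<=` `[0, len g] by apply: subset_itv; rewrite bnd_simp.
have pI u : u \in `[0, len g] -> -1 < p u < 1.
  move=> /unit vu; rewrite -ltr_norml normrM gtr0_norm//.
  apply: le_lt_trans k1; rewrite ler_piMr// ?(ltW k0)//.
  by rewrite (le_trans (ler_norm_dot _ _))// w1 vu mulr1.
have cp : {within `[s, t], continuous p}.
  move=> u; apply: cvgM; first exact: cvg_cst.
  by case: C1 => _ /(within_dot (w := w))/(continuous_subspaceW sub); exact.
have cG : {within `[s, t], continuous G}.
  apply/subspace_continuousP => u ust.
  apply: (@cvg_comp _ _ _ p (@acos R) _ (nbhs (p u))).
    by move/subspace_continuousP : cp; exact.
  exact: (continuous_acos (pI u (sub u ust))).
have dG u : u \in `]s, t[ -> u \notin e ->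
    exists2 l, is_derive u (1 : R) G l & `|l| <= 1.
  move=> ust ue.
  have uI : u \in `]0, len g[.
    move: ust; rewrite !in_itv/= => /andP[su ut].
    by rewrite (le_lt_trans s0 su) (lt_le_trans ut tg).
  have uI' := subset_itv_oo_cc uI.
  have [a [da a1 va]] := eP u uI ue.
  have dp : is_derive u (1 : R) p (k * dot w a).
    by have daw := is_derive_dot w da; exact: is_deriveZ.
  exists (- (Num.sqrt (1 - p u ^+ 2))^-1 * (k * dot w a)).
    by apply: is_derive1_comp; exact: is_derive1_acos (pI u uI').
  have pu1 : 0 < 1 - p u ^+ 2.
    rewrite subr_gt0 -real_normK ?num_real// expr_lt1// ltr_norml.
    exact: pI.
  (* With [x = dot w a] and [y = dot w (vel g u)], the claim is [k^2 x^2 <= 1 - k^2 y^2]. It follows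
     from [x^2 <= 1 - y^2] and [k^2 < 1]. *)
  rewrite normrM normrN normfV mulrC ler_pdivrMr ?normr_gt0 ?gt_eqF ?sqrtr_gt0//.
  rewrite mul1r [leRHS]ger0_norm ?sqrtr_ge0// -sqrtr_sqr ler_sqrt ?(ltW pu1)//.
  have := sqr_dot_orthogonal (unit u uI') w1 a1 va.
  rewrite /p; set x := dot w a; set y := dot w (vel g u) => xy.
  have kk : k ^+ 2 < 1 by rewrite expr_lt1// ltW.
  have kk0 : 0 < k ^+ 2 by rewrite exprn_gt0.
  rewrite !exprMn. apply: (@le_trans _ _ (k ^+ 2 * (1 - y ^+ 2))).
    by rewrite ler_pM2l.
  by rewrite mulrBr mulr1 lerD2r ltW.
(* The values 1 and -1 of [c] give the two sides of the Lipschitz bound. *)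
have mono (c : R) : `|c| = 1 -> s + c * G s <= t + c * G t.
  move=> c1; apply: (@nondecreasing_off_finite R e (fun u => u + c * G u)) => //.
    move=> u; apply: cvgD; first by apply: continuous_subspaceT => ?; exact: cvg_id.
    by apply: cvgM; [exact: cvg_cst|exact: cG].
  move=> u ust ue; have [l dl l1] := dG u ust ue.
  exists (1 + c * l).
    have dcl : is_derive u (1 : R) (fun v => c * G v) (c * l) by exact: is_deriveZ.
    by apply: is_deriveD.
  rewrite -lerBlDl sub0r; have := ler_norm (- (c * l)).
  by rewrite normrN normrM c1 mul1r; lra.
have := mono 1 (normr1 _); have := mono (-1) (normrN1 _).
rewrite ler_norml /G/= /p; lra.
Qed.

(** Use the factor [cos x] with small [x > 0] in [acos_dot_vel_lipschitz]: the angle is exactly [x]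
    at [m], hence at most [x + h] at [s], where [h] is the distance from [s] to [m]. Apply [cos] and
    let [x] tend to 0. *)
Lemma vel_angle g (s m : R) : bounded_curvature g ->
  s \in `[0, len g] -> m \in `[0, len g] -> `|s - m| <= pi ->
  cos (s - m) <= dot (vel g m) (vel g s).
Proof.
move=> bg sI mI; have [_ _ _ unit _] := bg.
have := ler_norm_dot (vel g m) (vel g s).
have vv : dot (vel g m) (vel g m) = 1 by rewrite -enorm_sqr unit// expr1n.
rewrite !unit// mulr1 ler_norml => /andP[pN1 p1].
have -> : cos (s - m) = cos `|s - m|.
  by case: (ger0P (s - m)) => _; rewrite ?cosN.
have := normr_ge0 (s - m); set h := `|s - m| => h0.
rewrite le_eqVlt => /orP[/eqP ->|hpi]; first by rewrite cospi.
set p := dot _ _ in p1 pN1 *.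
have step (x : R) : 0 < x -> x < pi / 2 -> x + h < pi -> cos (x + h) <= cos x * p.
  move=> x0 x2 xh.
  have xpi : x < pi by apply: le_lt_trans xh; rewrite lerDl.
  have kI : 0 < cos x < 1.
    rewrite cos_gt0_pihalf ?x2 ?andbT; last first.
      by rewrite (lt_trans _ x0)// oppr_lt0 divr_gt0 ?pi_gt0.
    by rewrite -cos0 ltr_cos// in_itv/= ?lexx ?pi_ge0// !ltW.
  have acosx : acos (cos x * dot (vel g m) (vel g m)) = x.
    by rewrite vv mulr1 cosK// in_itv/= !ltW.
  have cxp : -1 <= cos x * p <= 1.
    have /andP[/ltW c0 /ltW c1] := kI.
    by rewrite -ler_norml normrM ger0_norm// mulr_ile1// ler_norml pN1.
  have acosle : acos (cos x * p) <= x + h.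
    move: (sI) (mI); rewrite !in_itv/= => /andP[s0 sg] /andP[m0 mg].
    have [ms|sm] := leP m s.
      have := acos_dot_vel_lipschitz bg (unit m mI) kI m0 ms sg.
      have -> : h = s - m by rewrite /h ger0_norm ?subr_ge0.
      by rewrite acosx -/p ler_norml => /andP[_]; lra.
    have := acos_dot_vel_lipschitz bg (unit m mI) kI s0 (ltW sm) mg.
    have -> : h = m - s by rewrite /h distrC ger0_norm ?subr_ge0 ?ltW.
    by rewrite acosx -/p ler_norml => /andP[]; lra.
  rewrite -[leRHS]acosK ?in_itv//.
  rewrite leNgt ltr_cos -?leNgt// in_itv/= ?acos_ge0 ?acos_lepi//.
  by rewrite addr_ge0 ?(ltW x0)// ltW.
(* If [p < cos h], then by continuity [cos x * p < cos (x + h)] for some small [x > 0], against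
   [step]. *)
rewrite leNgt; apply/negP => ph.
have cphi : {for 0, continuous (fun x : R => cos x * p - cos (x + h))}.
  apply: cvgB.
    by apply: cvgM; [exact: continuous_cos|exact: cvg_cst].
  apply: continuous_comp; last exact: continuous_cos.
  by apply: cvgD; [exact: cvg_id|exact: cvg_cst].
have phi0 : cos 0 * p - cos (0 + h) < 0 by rewrite cos0 mul1r add0r subr_lt0.
have [d /= d0 dP] := (nbhs_ballP _ _).1 (cphi _ (lt_nbhsl phi0)).
pose x := Num.min d (Num.min (pi / 2) (pi - h)) / 2.
have m0 : 0 < Num.min d (Num.min (pi / 2) (pi - h)).
  by rewrite !lt_min d0 divr_gt0 ?pi_gt0// subr_gt0.
have x0 : 0 < x by rewrite divr_gt0.
have : x < Num.min d (Num.min (pi / 2) (pi - h)) by rewrite /x; lra.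
rewrite !lt_min => /and3P[xd xpi xh].
have := dP x; rewrite /ball/= sub0r normrN gtr0_norm// => /(_ xd).
by rewrite subr_lt0 ltNge step//; lra.
Qed.

End angle.

(** * Rigidity of short unit arcs *)

Section arcs.
Variable R : realType.
Implicit Types (w : R * R) (g h : plane_path R) (s t : R).

Definition unit_vec t : R * R := (cos t, sin t).

Lemma circle_unit_vec t : unit_vec t \in @circle R.
Proof. by apply/mem_set; rewrite /circle /enorm /= cos2Dsin2 sqrtr1. Qed.

Lemma enorm_unit_vec t : enorm (unit_vec t) = 1.
Proof. by have := circle_unit_vec t; rewrite inE. Qed.

Lemma unit_vec_continuous : continuous unit_vec.
Proof.
move=> u; apply: (@cvg_pair _ _ _ _ (nbhs (cos u)) (nbhs (sin u))).
  exact: continuous_cos.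
exact: continuous_sin.
Qed.

(** The unit circle centred at [(0, 1)], run through counterclockwise from the origin. *)
Definition arc_end t : UT R :=
  ((sin t, 1 - cos t), exist _ (unit_vec t) (circle_unit_vec t)).

Definition arc_path t : plane_path R :=
  PlanePath t (fun u => (sin u, 1 - cos u)) unit_vec.

Lemma is_derive_pair (f h : R -> R) (t a b : R) :
  is_derive t (1 : R) f a -> is_derive t (1 : R) h b ->
  is_derive t (1 : R) (fun u => (f u, h u)) (a, b).
Proof.
move=> [df fa] [dh hb].
suff C : (fun k => k^-1 *: (((fun u => (f u, h u)) \o shift t) (k *: (1 : R)) -
    (f t, h t))) @ 0^' --> (a, b).
  by split; [apply/cvg_ex; exists (a, b) | exact/cvg_lim].
have -> : (fun k => k^-1 *: (((fun u => (f u, h u)) \o shift t) (k *: (1 : R)) -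
    (f t, h t))) = (fun k => (k^-1 *: ((f \o shift t) (k *: (1 : R)) - f t),
                             k^-1 *: ((h \o shift t) (k *: (1 : R)) - h t))).
  by apply/funext.
by apply: (@cvg_pair _ _ _ _ (nbhs a) (nbhs b)); [rewrite -fa|rewrite -hb].
Qed.

Lemma arc_pos_derive t :
  is_derive t (1 : R) (fun u => (sin u, 1 - cos u)) (unit_vec t).
Proof.
apply: is_derive_pair; have -> : sin t = 0 - - sin t by rewrite sub0r opprK.
by apply: is_deriveB.
Qed.

Lemma arc_vel_derive t :
  is_derive t (1 : R) unit_vec (- sin t, cos t).
Proof. exact: is_derive_pair. Qed.

Lemma arc_bounded_curvature t : 0 <= t -> bounded_curvature (arc_path t).
Proof.
move=> t0; have cacc : continuous (fun u : R => (- sin u, cos u)).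
  move=> u; apply: (@cvg_pair _ _ _ _ (nbhs (- sin u)) (nbhs (cos u))).
    by apply: cvgN; exact: continuous_sin.
  exact: continuous_cos.
have cvel := unit_vec_continuous.
split => //=.
- split=> [u _|]; last exact: continuous_subspaceT.
  by apply: is_derive_has_deriv_within; exact: arc_pos_derive.
- apply/piecewise_C2P => /=; move: t0.
  rewrite le_eqVlt => /predU1P[<-|t0]; first exact: piecewise_nil.
  apply: piecewise_cons t0 _ (piecewise_nil _ _).
  exists (fun u => (- sin u, cos u)); split; first exact: continuous_subspaceT.
  by move=> u _; apply: is_derive_has_deriv_within; exact: arc_vel_derive.
- by move=> u _; exact: enorm_unit_vec.
- move=> u _ _; rewrite (derive_val (is_derive := arc_vel_derive u)).
  by rewrite /enorm/= sqrrN addrC cos2Dsin2 sqrtr1.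
Qed.

Lemma arc_Gamma t : 0 <= t -> Gamma (origin_right R) (arc_end t) (arc_path t).
Proof.
move=> t0; apply/GammaP; split; first exact: arc_bounded_curvature.
split; rewrite /base_point /tangent //= ?/unit_vec ?sin0 ?cos0 ?subrr//.
Qed.

(** For every [w], the product of [w] with the difference of positions starts at 0 and has
    derivative 0, so it is nonnegative; take for [w] the opposite of the difference. *)
Lemma pos_eq g h : bounded_curvature g -> C1_path h -> len h = len g ->
  pos g 0 = pos h 0 -> {in `[0, len g], vel g =1 vel h} ->
  {in `[0, len g], pos g =1 pos h}.
Proof.
move=> [_ C1g _ _ _] C1h hg gh0 vgh t tI.
have ge0 w : 0 <= dot w (pos g t - pos h t).
  have -> : 0 = dot w (pos g 0 - pos h 0) by rewrite gh0 subrr /dot/= !mulr0 addr0.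
  move: (tI); rewrite in_itv/= => /andP[t0 tg].
  have sub : `[0, t] `<=` `[0, len g] by apply: subset_itv; rewrite bnd_simp.
  apply: (@nondecreasing_off_finite R [::] (fun u => dot w (pos g u - pos h u))) => //.
    apply: within_dot => u; apply: cvgB.
      exact: (continuous_subspaceW sub (C1_pos_continuous C1g)).
    by move: (C1_pos_continuous C1h); rewrite hg => /(continuous_subspaceW sub); exact.
  move=> u; rewrite in_itv/= => /andP[u0 ut] _.
  have uI : u \in `]0, len g[ by rewrite in_itv/= u0 (lt_le_trans ut).
  exists (dot w (vel g u - vel h u)).
    apply: is_derive_dot; apply: is_deriveB; first exact: C1_pos_derive.
    by apply: C1_pos_derive; rewrite ?hg.
  by rewrite vgh ?subset_itv_oo_cc// subrr /dot/= !mulr0 addr0.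
apply/eqP; rewrite -subr_eq0; apply/eqP/enorm0_eq0/eqP.
rewrite -sqrf_eq0 eq_le sqr_ge0 andbT enorm_sqr -oppr_ge0 -dotNr -opprB.
have := ge0 (pos h t - pos g t); rewrite opprK /dot /=; lra.
Qed.

(** The vector [(- sin a, cos a)] is normal to [unit_vec a], so [v] is a multiple of [unit_vec a],
    and its norm makes the factor 1 or -1. *)
Lemma unit_vec_orthogonal (v : R * R) a : enorm v = 1 ->
  dot (- sin a, cos a) v = 0 -> v = unit_vec a \/ v = - unit_vec a.
Proof.
move=> v1 nv; pose c := dot (unit_vec a) v.
have cs : cos a ^+ 2 + sin a ^+ 2 = 1 := cos2Dsin2 a.
have vc : v = c *: unit_vec a.
  rewrite /c; move: nv; case: v {v1 c} => v1 v2; rewrite /dot /unit_vec/= => nv.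
  apply/eqP; rewrite -subr_eq0; apply/eqP; congr pair; rewrite /= /GRing.scale/=.
    transitivity (v1 * (1 - (cos a ^+ 2 + sin a ^+ 2)) -
      sin a * (- sin a * v1 + cos a * v2)); first by ring.
    by rewrite cs nv subrr !mulr0 subr0.
  transitivity (v2 * (1 - (cos a ^+ 2 + sin a ^+ 2)) +
    cos a * (- sin a * v1 + cos a * v2)); first by ring.
  by rewrite cs nv subrr !mulr0 addr0.
have := v1; rewrite vc enormZ enorm_unit_vec mulr1 => /eqP.
rewrite eqr_norml ler01 andbT => /orP[]/eqP ->.
  by left; rewrite scale1r.
by right; rewrite scaleN1r.
Qed.

Lemma ltr_sin_pi (a x : R) : 0 <= a -> a < x -> x < pi - a -> sin a < sin x.
Proof.
move=> a0 ax xa.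
have main y : a < y -> y <= pi / 2 -> sin a < sin y.
  move=> ay y2; rewrite ltr_sin// in_itv/=; have := pi_gt0 R; lra.
have [x2|x2] := leP x (pi / 2); first exact: main.
have -> : sin x = sin (pi - x) by rewrite addrC sinDpi sinN opprK.
by apply: main; lra.
Qed.

(** With [a = t / 2], the chord of the arc has length [2 sin a] and direction [unit_vec a].
    Comparison along the chord fixes the length; at length [t] the turning bounds from both ends
    leave only one velocity at each time. *)
Lemma arc_rigid t g : 0 <= t -> t < pi ->
  Gamma (origin_right R) (arc_end t) g -> len g < pi ->
  len g = t /\ {in `[0, len g], vel g =1 unit_vec}.
Proof.
move=> t0 tpi /GammaP[bg]; rewrite /base_point /tangent/= => -[p0 v0 pL vL] Lpi.
have [L0 C1 _ unit _] := bg.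
have I0 : 0 \in `[0, len g] by rewrite in_itv/= lexx.
have IL : len g \in `[0, len g] by rewrite in_itv/= lexx L0.
have dist u v : u \in `[0, len g] -> v \in `[0, len g] -> `|u - v| <= pi.
  rewrite !in_itv/= => /andP[? ?] /andP[? ?]; rewrite ler_norml; lra.
pose a := t / 2; have ta : t = a + a by rewrite /a -splitr.
have a0 : 0 <= a by rewrite divr_ge0.
have a2 : a < pi / 2 by rewrite /a ltr_pM2r.
have lenE : len g = t.
  (* The component of the velocity normal to the chord goes from [- sin a] to [sin a], so it
     vanishes at some time [m]. *)
  have [m mI nm] : exists2 m, m \in `[0, len g] &
      dot (- sin a, cos a) (vel g m) = 0.
    apply: IVT => //; first by apply: within_dot; case: C1.
    have -> : dot (- sin a, cos a) (vel g 0) = - sin a.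
      by rewrite v0 /dot/= mulr1 mulr0 addr0.
    have -> : dot (- sin a, cos a) (vel g (len g)) = sin a.
      rewrite vL /dot/=; transitivity (sin t * cos a - cos t * sin a).
        by ring.
      by rewrite -sinB ta addrK.
    have sa : 0 <= sin a by rewrite sin_ge0_pi//; lra.
    by rewrite ge_min le_max sa oppr_le0 sa orbT.
  have [c vm c2] : exists2 c, vel g m = c *: unit_vec a & c = 1 \/ c = -1.
    have [vm|vm] := unit_vec_orthogonal (unit m mI) nm.
      by exists 1; [rewrite scale1r|left].
    by exists (-1); [rewrite scaleN1r|right].
  have Xm : dot (vel g 0) (vel g m) = c * cos a.
    by rewrite v0 vm dotZr /dot/= mul1r mul0r addr0.
  have Ym : dot (vel g (len g)) (vel g m) = c * cos a.
    by rewrite vL vm dotZr /dot/= -cosB ta addrK.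
  have := vel_angle bg mI I0 (dist _ _ mI I0).
  rewrite Xm subr0 => m1.
  have := vel_angle bg mI IL (dist _ _ mI IL).
  rewrite Ym -[cos (m - _)]cosN opprB => m2.
  move: (mI); rewrite in_itv/= => /andP[m0 mL].
  have cosle x y : 0 <= x -> x <= pi -> 0 <= y -> y <= pi -> cos x <= cos y -> y <= x.
    by move=> ? ? ? ?; rewrite !leNgt; apply: contra; rewrite ltr_cos ?in_itv/= //; lra.
  have pi0 := pi_gt0 R.
  case: c2 => cE; rewrite cE ?mul1r ?mulN1r in m1 m2.
    (* The velocity at [m] points along the chord: the turn by [a] before [m] and the one after [m]
       each take time at least [a]. *)
    have am : a <= m by apply: cosle m1; lra.
    have aLm : a <= len g - m by apply: cosle m2; lra.
    (* The derivative of the function compared here is nonnegative by [vel_angle]. The result is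
       [sin m + sin (len g - m) <= 2 sin a]. *)
    have mono : dot (vel g m) (pos g 0) - sin (0 - m) <=
                dot (vel g m) (pos g (len g)) - sin (len g - m).
      apply: (@nondecreasing_off_finite R [::]
        (fun u => dot (vel g m) (pos g u) - sin (u - m))) => //.
        move=> u; apply: cvgB.
          exact: (within_dot (C1_pos_continuous C1)).
        apply: continuous_subspaceT => {}u; apply: continuous_comp.
          by apply: cvgB; [exact: cvg_id|exact: cvg_cst].
        exact: continuous_sin.
      move=> u uI _; have uI' := subset_itv_oo_cc uI.
      exists (dot (vel g m) (vel g u) - cos (u - m) * (1 - 0)).
        by apply: is_deriveB; exact/is_derive_dot/C1_pos_derive.
      by rewrite subr0 mulr1 subr_ge0 vel_angle// dist.
    move: mono; rewrite vm cE scale1r p0 pL sub0r sinN opprK.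
    have -> : dot (unit_vec a) (base_point (origin_right R)) = 0.
      by rewrite /dot/= !mulr0 addr0.
    have -> : dot (unit_vec a) (sin t, 1 - cos t) = sin a + sin a.
      rewrite /dot/=; transitivity ((sin t * cos a - cos t * sin a) + sin a).
        by ring.
      by rewrite -sinB ta addrK.
    (* Since [len g < pi], both [m] and [len g - m] lie where the sine is at least [sin a], with
       equality only at [a]; hence both equal [a]. *)
    have lt_sin x : a < x -> x <= len g - a -> sin a < sin x.
      by move=> ax xL; apply: ltr_sin_pi => //; lra.
    have le_sin x : a <= x -> x <= len g - a -> sin a <= sin x.
      by rewrite le_eqVlt => /predU1P[<-//|/lt_sin h /h /ltW].
    have mLa : m <= len g - a by lra.
    have Lma : len g - m <= len g - a by lra.
    have := le_sin m am mLa; have := le_sin (len g - m) aLm Lma => sm sLm sum.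
    have ma : m <= a.
      by rewrite leNgt; apply/negP => /lt_sin /(_ mLa); lra.
    have Lm : len g - m <= a.
      by rewrite leNgt; apply/negP => /lt_sin /(_ Lma); lra.
    by lra.
  (* The velocity at [m] points against the chord: each side of [m] takes time at least [pi - a], so
     [len g >= 2 pi - t > pi]. *)
  have cpa : cos (pi - a) = - cos a by rewrite addrC cosDpi cosN.
  have am : pi - a <= m.
    by apply: cosle; rewrite ?cpa; lra.
  have aLm : pi - a <= len g - m.
    by apply: cosle; rewrite ?cpa; lra.
  by exfalso; lra.
split=> // s sI; move: (sI); rewrite in_itv/= lenE => /andP[s0 st].
have := vel_angle bg sI I0 (dist _ _ sI I0); rewrite subr0 v0 => X1.
have := vel_angle bg sI IL (dist _ _ sI IL); rewrite vL lenE => Y1.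
(* Up to the factor [sin t], [unit_vec s] is a nonnegative combination of the end velocities
   [(1, 0)] and [unit_vec t], so [X1] and [Y1] bound its product with [vel g s] below by 1. *)
have key : sin t * dot (unit_vec s) (vel g s) =
    sin (t - s) * dot (1, 0) (vel g s) + sin s * dot (unit_vec t) (vel g s).
  by rewrite sinB /dot/=; ring.
have [t00|tn0] := eqVneq t 0.
  have -> : s = 0 by lra.
  by rewrite v0 /unit_vec sin0 cos0.
have st0 : 0 < sin t by apply: sin_gt0_pi; rewrite lt_neqAle eq_sym tn0 t0.
have : 1 <= dot (unit_vec s) (vel g s).
  rewrite -(ler_pM2l st0) mulr1 key.
  have {1}-> : t = (t - s) + s by rewrite subrK.
  rewrite sinD; apply: lerD.
    by rewrite ler_wpM2l// sin_ge0_pi//; lra.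
  rewrite mulrC -[cos (t - s)]cosN opprB; rewrite ler_wpM2l// sin_ge0_pi//; lra.
(* Unit vectors with inner product at least 1 coincide. *)
move=> d1; apply/eqP; rewrite -subr_eq0; apply/eqP/enorm0_eq0/eqP.
rewrite -sqrf_eq0 eq_le sqr_ge0 andbT enorm_sqr.
have : dot (vel g s) (vel g s) = 1 by rewrite -enorm_sqr unit// expr1n.
have : dot (unit_vec s) (unit_vec s) = 1 by rewrite -enorm_sqr enorm_unit_vec expr1n.
move: d1; rewrite /dot/=; lra.
Qed.

End arcs.

(** * Homotopy classes *)

Section homotopy.
Variable R : realType.
Implicit Types (g h k : plane_path R) (x y : UT R) (H K : R -> plane_path R)
  (D S : set (plane_path R)).

Lemma C1_continuousP H : C1_continuous H <->
  forall t, t \in `[0, 1] -> forall e : R, 0 < e -> exists2 d : R, 0 < d &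
    forall u, u \in `[0, 1] -> `|u - t| < d -> `|C1_dist (H t) (H u)| < e.
Proof.
split=> [HH t tI e e0|HH t tI].
  have /cvgrPdist_lt /(_ e e0) := HH t tI.
  rewrite near_withinE => /nbhs_ballP[d/= d0 dH]; exists d => // u uI ut.
  by have := dH u; rewrite /ball/= distrC sub0r normrN; apply.
apply/cvgrPdist_lt => e e0; have [d d0 dH] := HH t tI e e0.
rewrite near_withinE; apply/nbhs_ballP; exists d => // u /= ut uI.
by rewrite sub0r normrN; apply: dH => //; rewrite distrC.
Qed.

Lemma C1_continuous_affine H (a b : R) :
  0 <= b <= 1 -> 0 <= a + b <= 1 ->
  C1_continuous H -> C1_continuous (fun t => H (a * t + b)).
Proof.
move=> /andP[b0 b1] /andP[ab0 ab1] /C1_continuousP HH; apply/C1_continuousP.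
have aI t : t \in `[0, 1] -> a * t + b \in `[0, 1].
  rewrite !in_itv/= => /andP[t0 t1]; nra.
move=> t tI e /(HH _ (aI t tI))[d d0 dH].
have k0 : 0 < `|a| + 1 by rewrite ltr_wpDl.
exists (d / (`|a| + 1)); first by rewrite divr_gt0.
move=> u uI ut; apply: dH; first exact: aI.
rewrite (_ : _ - _ = a * (u - t)); last by ring.
move: ut; rewrite ltr_pdivlMr// normrM; apply: le_lt_trans.
by rewrite mulrC ler_wpM2l// lerDl.
Qed.

Definition concat_homotopy H K (t : R) : plane_path R :=
  if t <= 1 / 2 then H (2 * t) else K (2 * t - 1).

Lemma C1_continuous_concat H K : H 1 = K 0 ->
  C1_continuous H -> C1_continuous K -> C1_continuous (concat_homotopy H K).
Proof.
move=> HK /C1_continuousP cH /C1_continuousP cK; apply/C1_continuousP.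
move=> t; rewrite in_itv/= => /andP[t0 t1] e e0; rewrite /concat_homotopy.
have [tl|tr|->] := ltgtP t (1 / 2).
- have [|d d0 dH] := cH (2 * t) _ e e0; first by rewrite in_itv/=; lra.
  exists (Num.min (d / 2) (1 / 2 - t)); first by rewrite lt_min divr_gt0//=; lra.
  move=> u; rewrite in_itv/= => /andP[u0 u1]; rewrite lt_min => ut.
  rewrite !ltr_norml in ut.
  have -> : u <= 1 / 2 by lra.
  by apply: dH; rewrite ?in_itv/= ?ltr_norml; lra.
- have [|d d0 dH] := cK (2 * t - 1) _ e e0; first by rewrite in_itv/=; lra.
  exists (Num.min (d / 2) (t - 1 / 2)); first by rewrite lt_min divr_gt0//=; lra.
  move=> u; rewrite in_itv/= => /andP[u0 u1]; rewrite lt_min => ut.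
  rewrite !ltr_norml in ut.
  have -> : (u <= 1 / 2) = false by apply/negbTE; rewrite -ltNge; lra.
  by apply: dH; rewrite ?in_itv/= ?ltr_norml; lra.
- have -> : 2 * (1 / 2) = 1 :> R by lra.
  have [|d d0 dH] := cH 1 _ e e0; first by rewrite in_itv/=; lra.
  have [|d' d'0 d'H] := cK 0 _ e e0; first by rewrite in_itv/=; lra.
  exists (Num.min (d / 2) (d' / 2)); first by rewrite lt_min !divr_gt0.
  move=> u; rewrite in_itv/= => /andP[u0 u1]; rewrite lt_min => ut.
  rewrite !ltr_norml in ut.
  have [u2|u2] := leP u (1 / 2).
    by apply: dH; rewrite ?in_itv/= ?ltr_norml; lra.
  by rewrite HK; apply: d'H; rewrite ?in_itv/= ?ltr_norml; lra.
Qed.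

(** For [g] in [S], the set [joined S g] is the path component of [g] in [S]. *)
Definition joined S g h : Prop := exists H : R -> plane_path R,
  [/\ forall t, t \in `[0, 1] -> S (H t), C1_continuous H, H 0 = g & H 1 = h].

Lemma joined_sym S g h : joined S g h -> joined S h g.
Proof.
move=> [H [SH cH H0 H1]]; exists (fun t => H (-1 * t + 1)); split.
- by move=> t tI; apply: SH; move: tI; rewrite !in_itv/=; lra.
- by apply: C1_continuous_affine => //; lra.
- by rewrite mulr0 add0r.
- by rewrite mulr1 addNr.
Qed.

Lemma joined_trans S g h k : joined S g h -> joined S h k -> joined S g k.
Proof.
move=> [H [SH cH H0 H1]] [K [SK cK K0 K1]]; exists (concat_homotopy H K); split.
- move=> t tI; rewrite /concat_homotopy; case: leP => t2.
    by apply: SH; move: tI; rewrite !in_itv/=; lra.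
  by apply: SK; move: tI; rewrite !in_itv/=; lra.
- by apply: C1_continuous_concat => //; rewrite H1.
- by rewrite /concat_homotopy mulr0 ifT.
- rewrite /concat_homotopy ifF; last by apply/negbTE; rewrite -ltNge; lra.
  by rewrite mulr1 (_ : 2 - 1 = 1)//; ring.
Qed.

(** Each [H r] is reached from [g] along [t |-> H (r * t)], so the homotopy stays in the
    component. *)
Lemma joined_joined S g h : joined S g h -> joined (joined S g) g h.
Proof.
move=> [H [SH cH H0 H1]]; exists H; split => // r.
rewrite in_itv/= => /andP[r0 r1]; exists (fun t => H (r * t + 0)); split.
- by move=> t; rewrite in_itv/= => /andP[t0 t1]; apply: SH; rewrite in_itv/=; nra.
- by apply: C1_continuous_affine => //; lra.
- by rewrite mulr0 addr0.
- by rewrite mulr1 addr0.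
Qed.

Lemma sup_dist_refl (f : R -> R * R) : sup_dist f f = 0.
Proof.
rewrite /sup_dist (_ : [set _ | _ in _] = [set 0]) ?sup1//.
apply/seteqP; split=> z /=.
  by move=> [u _ <-]; rewrite subrr /enorm/= expr0n addr0 sqrtr0.
move=> ->; exists 0; first by rewrite /= in_itv/= lexx ler01.
by rewrite subrr /enorm/= expr0n addr0 sqrtr0.
Qed.

Lemma C1_dist_refl g : C1_dist g g = 0.
Proof. by rewrite /C1_dist !sup_dist_refl addr0. Qed.

Lemma joined_refl S g : S g -> joined S g g.
Proof.
move=> Sg; exists (fun=> g); split => //.
by apply/C1_continuousP => t _ e e0; exists 1 => // u _ _; rewrite C1_dist_refl normr0.
Qed.

Lemma path_connected_joined S g : path_connected (joined S g).
Proof.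
move=> h k gh gk; apply: (@joined_trans _ _ g).
  exact/joined_sym/joined_joined.
exact: joined_joined.
Qed.

(** The path component of [g] contains the path connected set [D], so maximality puts it inside
    [D]. *)
Lemma homotopy_class_joined x y D g h : homotopy_class x y D -> D g ->
  joined (Gamma x y) g h -> D h.
Proof.
move=> [DG Dc Dmax] Dg gh; apply: (Dmax (joined (Gamma x y) g)) => //.
- by move=> k [H [SH _ _ <-]]; apply: SH; rewrite in_itv/= lexx ler01.
- exact: path_connected_joined.
- move=> k Dk; have [H [SH cH H0 H1]] := Dc g k Dg Dk.
  by exists H; split => // t /SH /DG.
Qed.

Lemma joined_homotopy_class x y g : Gamma x y g ->
  homotopy_class x y (joined (Gamma x y) g).
Proof.
move=> Gg; split.
- by move=> k [H [SH _ _ <-]]; apply: SH; rewrite in_itv/= lexx ler01.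
- exact: path_connected_joined.
- move=> S SG Sc DS k Sk.
  have Sg : S g by apply: DS; exact: joined_refl.
  have [H [SH cH H0 H1]] := Sc g k Sg Sk.
  by exists H; split => // t /SH /SG.
Qed.

Lemma sup_dist_ge0 (f f' : R -> R * R) : 0 <= sup_dist f f'.
Proof.
rewrite /sup_dist; set A := [set _ | _ in _].
have A0 : A (enorm (f 0 - f' 0)).
  by exists 0 => //; rewrite /= in_itv/= lexx ler01.
(* Without an upper bound [sup] takes its default value 0. *)
have [Asup|nsup] := pselect (has_sup A); last by rewrite sup_out.
by apply: le_trans (enorm_ge0 _) (ub_le_sup Asup.2 A0).
Qed.

Lemma sup_dist_ge (f f' : R -> R * R) (u M : R) : u \in `[0, 1] ->
  (forall t, t \in `[0, 1] -> enorm (f t - f' t) <= M) ->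
  enorm (f u - f' u) <= sup_dist f f'.
Proof.
move=> uI fM; apply: ub_le_sup; last by exists u.
by exists M => _ [t tI <-]; exact: fM.
Qed.

Lemma sup_dist_le (f f' : R -> R * R) (M : R) :
  (forall t, t \in `[0, 1] -> enorm (f t - f' t) <= M) -> sup_dist f f' <= M.
Proof.
move=> fM; apply: ge_sup; last by move=> _ [t tI <-]; exact: fM.
by exists (enorm (f 0 - f' 0)); exists 0 => //; rewrite /= in_itv/= lexx ler01.
Qed.

(** At parameter 0 the constant speed velocities are [len g] and [len h] times the same unit vector
    [tangent x]. The bound [len g + len h] ensures that the supremum is a genuine one. *)
Lemma len_dist_le x y y' g h : Gamma x y g -> Gamma x y' h ->
  `|len g - len h| <= C1_dist g h.
Proof.
move=> /GammaP[[g0 _ _ ug _] [_ vg _ _]] /GammaP[[h0 _ _ uh _] [_ vh _ _]].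
rewrite /C1_dist -[leLHS]add0r lerD ?sup_dist_ge0//.
have I0 : (0 : R) \in `[0, 1] by rewrite in_itv/= lexx ler01.
have scaleI (l t : R) : 0 <= l -> t \in `[0, 1] -> l * t \in `[0, l].
  by move=> l0; rewrite !in_itv/= => /andP[? ?]; rewrite mulr_ge0// ler_piMr.
have := @sup_dist_ge (fun u => len g *: vel g (len g * u))
           (fun u => len h *: vel h (len h * u)) 0 (len g + len h) I0.
rewrite !mulr0 vg vh -scalerBl enormZ.
have := ug 0; rewrite vg in_itv/= lexx g0 => -> //; rewrite mulr1; apply.
move=> t tI; apply: le_trans (ler_enormD _ _) _; rewrite enormN !enormZ.
by rewrite ug ?uh ?scaleI// !mulr1 !ger0_norm.
Qed.

Lemma len_continuous x y H : (forall t, t \in `[0, 1] -> Gamma x y (H t)) ->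
  C1_continuous H -> {within `[0, 1], continuous (fun t => len (H t))}.
Proof.
move=> GH /C1_continuousP cH; apply/within_continuousP => t tI e e0.
have [d d0 dH] := cH t tI e e0; exists d => // u uI ut.
rewrite distrC; apply: le_lt_trans (dH u uI ut).
by apply: le_trans (len_dist_le (GH t tI) (GH u uI)) (ler_norm _).
Qed.

End homotopy.

Lemma arc_end_bounded_class (R : realType) (t : R) : 0 <= t -> t < pi ->
  bounded_class_endpoints (arc_end t).
Proof.
move=> t0 tpi; have Garc := arc_Gamma t0.
exists (joined (Gamma (origin_right R) (arc_end t)) (arc_path t)); split.
- by exists (arc_path t); exact: joined_refl.
- exact: joined_homotopy_class.
right; suff rigid g : joined (Gamma (origin_right R) (arc_end t)) (arc_path t) g ->
    [/\ Gamma (origin_right R) (arc_end t) g, len g = t &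
      {in `[0, len g], vel g =1 @unit_vec R}].
  move=> g h /rigid[/GammaP[bg [g0 _ _ _]] gt vg] /rigid[/GammaP[bh [h0 _ _ _]] ht vh].
  split; first by rewrite gt ht.
  apply: pos_eq => //; [by case: bh|by rewrite gt ht|by rewrite g0 h0|].
  by move=> u uI; rewrite vg ?vh// ht -gt.
move=> [H [GH cH H0 H1]].
have I1 : (1 : R) \in `[0, 1] by rewrite in_itv/= ler01 lexx.
have Gg : Gamma (origin_right R) (arc_end t) g by rewrite -H1; exact: GH.
suff gpi : len g < pi by have [] := arc_rigid t0 tpi Gg gpi.
rewrite ltNge; apply/negP => gpi.
(* A homotopy from length [t] to a length at least [pi] would pass through the intermediate length
   [v], which [arc_rigid] forbids. *)
pose v := (t + pi) / 2.
have [|c cI cv] := @IVT _ (fun u => len (H u)) 0 1 v ler01 (len_continuous GH cH).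
  by rewrite H0 H1 /= ge_min le_max /v; apply/andP; split; apply/orP; [left|right]; lra.
have [] := arc_rigid t0 tpi (GH c cI); first by rewrite cv /v; lra.
by rewrite cv /v; lra.
Qed.

(** * Inserting straight segments *)

Section stretch.
Variable R : realType.
Implicit Types (g h : plane_path R) (x y : UT R) (s t u : R).

(** For [s >= 0], a clock that stops at [t] for a duration [s] and then runs on. *)
Definition hold t s u : R := Num.min u (Num.max t (u - s)).

(** The time already spent on the segment is [u - hold t s u], so one formula covers the path
    before, along and after it. *)
Definition insert_segment g t s : plane_path R :=
  PlanePath (len g + s)
    (fun u => pos g (hold t s u) + (u - hold t s u) *: vel g t)
    (fun u => vel g (hold t s u)).

Lemma hold_before t s u : u <= t -> hold t s u = u.
Proof. by move=> ut; apply/min_idPl; rewrite le_max ut. Qed.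

Lemma hold_during t s u : t <= u -> u <= t + s -> hold t s u = t.
Proof.
move=> tu us; rewrite /hold (_ : Num.max t (u - s) = t).
  exact/min_idPr.
by apply/max_idPl; rewrite lerBlDr.
Qed.

Lemma hold_after t s u : 0 <= s -> t + s <= u -> hold t s u = u - s.
Proof.
move=> s0 tsu; rewrite /hold (_ : Num.max t (u - s) = u - s).
  by apply/min_idPr; rewrite gerBl.
by apply/max_idPr; rewrite lerBrDr.
Qed.

Lemma hold0 t u : hold t 0 u = u.
Proof. by apply/min_idPl; rewrite subr0 le_max lexx orbT. Qed.

Lemma hold_cases t s u : 0 <= s ->
  [\/ u <= t /\ hold t s u = u,
      [/\ t <= u, u <= t + s & hold t s u = t] |
      t + s <= u /\ hold t s u = u - s].
Proof.
move=> s0; have [ut|/ltW tu] := leP u t.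
  by apply: Or31; split=> //; exact: hold_before.
have [us|/ltW su] := leP u (t + s).
  by apply: Or32; split=> //; exact: hold_during.
by apply: Or33; split=> //; exact: hold_after.
Qed.

Lemma hold_lipschitz t s s' u u' : 0 <= s -> 0 <= s' ->
  `|hold t s u - hold t s' u'| <= `|s - s'| + `|u - u'|.
Proof.
move=> s0 s'0; have := ler_norm (s - s'); have := ler_norm (- (s - s')).
have := ler_norm (u - u'); have := ler_norm (- (u - u')); rewrite !normrN.
rewrite ler_norml.
case: (hold_cases t u s0) => [[? ->]|[? ? ->]|[? ->]];
case: (hold_cases t u' s'0) => [[? ->]|[? ? ->]|[? ->]]; lra.
Qed.

Lemma hold_itv t s u l : 0 <= s -> t \in `[0, l] -> u \in `[0, l + s] ->
  hold t s u \in `[0, l].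
Proof.
move=> s0; rewrite !in_itv/=.
by case: (hold_cases t u s0) => [[? ->]|[? ? ->]|[? ->]]; lra.
Qed.

Lemma subr_hold_itv t s u : 0 <= s -> 0 <= u - hold t s u <= s.
Proof.
by move=> s0; case: (hold_cases t u s0) => [[? ->]|[? ? ->]|[? ->]]; lra.
Qed.

Lemma insert_segment0 g t : insert_segment g t 0 = g.
Proof.
rewrite /insert_segment addr0; case: g => l p v /=; congr PlanePath.
  by apply/funext => u; rewrite hold0 subrr scale0r addr0.
by apply/funext => u; rewrite hold0.
Qed.

(** A limit of difference quotients of norm at most 1. This yields the curvature bound wherever the
    velocity is derivable, including the ends of an inserted segment. *)
Lemma lipschitz_derive_le1 (f : R -> R * R) t l :
  t \in `]0, l[ -> derivable f t 1 ->
  {in `[0, l] &, forall u v, enorm (f u - f v) <= `|u - v|} ->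
  enorm ('D_1 f t) <= 1.
Proof.
move=> tI df flip; apply: enorm_le_dot => // w; rewrite mulr1.
have := is_derive_dot w (DeriveDef df erefl).
case=> dw <-.
apply: limr_le => //.
move: (tI); rewrite in_itv/= => /andP[t0 tl].
rewrite near_withinE; apply/nbhs_ballP; exists (Num.min t (l - t)) => /=.
  by rewrite lt_min t0 subr_gt0.
move=> k; rewrite /ball/= sub0r normrN lt_min !ltr_norml => kI k0.
have nk0 : 0 < `|k| by rewrite normr_gt0.
rewrite /shift /= /GRing.scale /= mulr1 -dotNr -dotDr.
apply: (le_trans (ler_norm _)); rewrite normrM normfV mulrC ler_pdivrMr//.
apply: (le_trans (ler_norm_dot _ _)); rewrite ler_wpM2l ?enorm_ge0//.
have := flip (k + t) t; rewrite addrK; apply; rewrite in_itv/=; lra.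
Qed.

(** Away from [b] only one piece comes near the point and the condition on the other is vacuous; at
    [b] both conditions hold with the same value [v b]. *)
Lemma has_deriv_within_itv_cat (f v : R -> R * R) a b c : a <= b -> b <= c ->
  {in `[a, b], forall u, has_deriv_within `[a, b] f u (v u)} ->
  {in `[b, c], forall u, has_deriv_within `[b, c] f u (v u)} ->
  {in `[a, c], forall u, has_deriv_within `[a, c] f u (v u)}.
Proof.
move=> ab bc fab fbc u uI; move: (uI); rewrite in_itv/= => /andP[au uc].
have sub : `[a, c]%classic `<=` `[a, b] `|` `[b, c].
  move=> r /=; rewrite !in_itv/= => /andP[ar rc].
  by have [rb|/ltW br] := leP r b; [left; rewrite ar|right; rewrite br].
apply: has_deriv_withinW sub _; apply: has_deriv_within_glue.
  have [ub|bu] := leP u b; first by apply: fab; rewrite in_itv/= au.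
  apply: (@has_deriv_within_sep _ _ _ _ _ (u - b)); rewrite ?subr_gt0// => r /=.
  by rewrite in_itv/= distrC => /andP[_ rb]; apply: le_trans (ler_norm _); lra.
have [bu|ub] := leP b u; first by apply: fbc; rewrite in_itv/= bu.
apply: (@has_deriv_within_sep _ _ _ _ _ (b - u)); rewrite ?subr_gt0// => r /=.
by rewrite in_itv/= => /andP[br _]; apply: le_trans (ler_norm _); lra.
Qed.

(** Composition with [hold] keeps the velocity 1-Lipschitz, which gives its continuity and the
    curvature bound. The derivative of the position is computed on three pieces and glued. *)
Lemma insert_segment_bounded_curvature g t s : bounded_curvature g ->
  t \in `[0, len g] -> 0 <= s -> bounded_curvature (insert_segment g t s).
Proof.
move=> bg tI; rewrite le_eqVlt => /predU1P[<-|s0]; first by rewrite insert_segment0.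
have [L0 [dpos cvel] C2 unit curv] := bg.
have s0' := ltW s0; have vlip := vel_lipschitz bg.
move: (tI); rewrite in_itv/= => /andP[t0 tL].
have vlip' : {in `[0, len g + s] &, forall u v,
    enorm (vel g (hold t s u) - vel g (hold t s v)) <= `|u - v|}.
  move=> u v uI vI; apply: le_trans (vlip _ _ _ _) _; rewrite ?hold_itv//.
  by have := hold_lipschitz t u v s0' s0'; rewrite subrr normr0 add0r.
split => /=; first exact: addr_ge0.
- split; last first.
    apply/within_continuousP => u uI e e0; exists e => // v vI vu /=.
    apply: le_lt_trans (norm_le_enorm _) _; apply: le_lt_trans vu.
    exact: vlip'.
  pose p u := pos g (hold t s u) + (u - hold t s u) *: vel g t.
  pose v u := vel g (hold t s u).
  have before u : u \in `[0, t] -> has_deriv_within `[0, t] p u (v u).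
    move=> uI; move: (uI); rewrite in_itv/= => /andP[u0 ut].
    rewrite /v hold_before//.
    apply: (@has_deriv_within_eq _ _ (pos g)) => //.
      move=> r; rewrite inE /p/= in_itv/= => /andP[_ rt].
      by rewrite hold_before// subrr scale0r addr0.
    apply: (@has_deriv_withinW _ _ `[0, len g]).
      by apply: subset_itvl; rewrite bnd_simp.
    by apply: dpos; rewrite in_itv/= u0 (le_trans ut).
  have during u : u \in `[t, t + s] -> has_deriv_within `[t, t + s] p u (v u).
    move=> uI; move: (uI); rewrite in_itv/= => /andP[tu ut].
    rewrite /v hold_during//.
    apply: (@has_deriv_within_eq _ _ (fun r => pos g t + (r - t) *: vel g t)) => //.
      move=> r; rewrite inE /p/= in_itv/= => /andP[tr rt].
      by rewrite hold_during.
    apply/has_deriv_withinP => e e0; exists 1 => // r _ ru _.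
    rewrite opprD addrACA subrr add0r -scalerBl opprB addrA subrK scalerA.
    by rewrite mulVf ?subr_eq0// scale1r subrr normr0.
  have after u : u \in `[t + s, len g + s] ->
      has_deriv_within `[t + s, len g + s] p u (v u).
    move=> uI; move: (uI); rewrite in_itv/= => /andP[tu ut].
    rewrite /v hold_after//.
    have usI : u - s \in `[t, len g] by rewrite in_itv/= lerBrDr lerBlDr tu.
    have D : has_deriv_within `[t, len g] (pos g) (u - s) (vel g (u - s)).
      apply: (@has_deriv_withinW _ _ `[0, len g]).
        by apply: subset_itvr; rewrite bnd_simp.
      by apply: dpos; move: usI; rewrite !in_itv/= => /andP[/(le_trans t0) ->].
    have := has_deriv_within_shift s (s *: vel g t) D; rewrite subrK.
    have -> : [set r | `[t, len g]%classic (r - s)] = `[t + s, len g + s]%classic.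
      by apply/seteqP; split=> r /=; rewrite !in_itv/= lerBrDr lerBlDr.
    apply: has_deriv_within_eq => // r; rewrite inE /p/= in_itv/= => /andP[tr rt].
    by rewrite hold_after// subKr.
  apply: (@has_deriv_within_itv_cat _ _ 0 (t + s)); rewrite ?addr_ge0 ?lerD2r//.
  by apply: has_deriv_within_itv_cat during; rewrite ?lerDl.
- apply/piecewise_C2P; move/piecewise_C2P : C2 => C2.
  have C2W c d c' d' : C2_on (vel g) c d -> c <= c' -> c' < d' -> d' <= d ->
      C2_on (vel g) c' d' by move=> cd cc' _ dd'; exact: C2_onW cd cc' dd'.
  have [C2l C2r] := piecewise_split C2W C2 t0 tL.
  apply: (piecewise_cat (b := t)).
    apply: piecewise_sub C2l => c d c0 cd dt; apply: C2_on_eq => u.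
    rewrite in_itv/= => /andP[_ ud]; rewrite hold_before//; exact: le_trans dt.
  apply: (@piecewise_cons _ _ _ (t + s)); first by rewrite ltrDl.
    exists (fun=> 0); split=> [|u uI].
      by apply: continuous_subspaceT => ?; exact: cvg_cst.
    apply: (@has_deriv_within_eq _ _ (fun=> vel g t)) => //.
      by move=> r; rewrite inE/= in_itv/= => /andP[tr rt]; rewrite hold_during.
    apply/has_deriv_withinP => e e0; exists 1 => // r _ _ _.
    by rewrite subrr scaler0 subrr normr0.
  (* Each piece records that it lies beyond [t], since only there does [hold] act as the shift by
     [s]. *)
  have C2r' : piecewise (fun c d => t <= c /\ C2_on (vel g) c d) t (len g).
    by apply: piecewise_sub C2r => c d tc _ _ cd.
  apply: piecewise_shift C2r' => c d [tc]; apply: C2_on_shift => u.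
  rewrite in_itv/= => /andP[cu _]; rewrite hold_after ?addrK//.
  by rewrite lerD2r (le_trans tc).
- by move=> u uI; apply: unit; exact: hold_itv.
- move=> u uI du; exact: (lipschitz_derive_le1 uI du vlip').
Qed.

End stretch.

(** * Lipschitz families of paths and homotopies by stretching *)

Section families.
Variable R : realType.
Implicit Types (g h : plane_path R) (x y : UT R) (s t u : R)
  (G : R -> plane_path R).

(** Joint control in the parameter and in time, for paths of different lengths: it is preserved by
    inserting segments and implies [C1_continuous]. *)
Definition lipschitz_family G : Prop := exists2 K : R, 0 <= K &
  {in `[0, 1] &, forall r r', `|len (G r) - len (G r')| <= K * `|r - r'| /\
    {in `[0, len (G r)] & `[0, len (G r')], forall u u',
      enorm (pos (G r) u - pos (G r') u') <= K * (`|r - r'| + `|u - u'|) /\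
      enorm (vel (G r) u - vel (G r') u') <= K * (`|r - r'| + `|u - u'|)}}.

Lemma lipschitz_family_cst g : bounded_curvature g -> lipschitz_family (fun=> g).
Proof.
move=> bg; exists 1 => // r r' _ _; rewrite subrr normr0 mul1r; split=> // u u' uI u'I.
rewrite mul1r; split.
  by apply: le_trans (pos_lipschitz bg uI u'I) _; rewrite lerDr.
by apply: le_trans (vel_lipschitz bg uI u'I) _; rewrite lerDr.
Qed.

Lemma lipschitz_family_insert G t s : 0 <= s -> lipschitz_family G ->
  (forall r, r \in `[0, 1] -> bounded_curvature (G r) /\ t \in `[0, len (G r)]) ->
  lipschitz_family (fun r => insert_segment (G r) t (r * s)).
Proof.
move=> s0 [K K0 GK] bG; exists (K + 2 * K * s + s + 2).
  (* The position needs the largest constant: its difference is at most [(K + 2 K s + s) |r - r'| +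
     (K + 2) |u - u'|]. *)
  by rewrite !addr_ge0 ?mulr_ge0.
move=> r r' rI r'I; have [lenK GrK] := GK r r' rI r'I.
have [bGr tr] := bG r rI; have [bGr' tr'] := bG r' r'I.
have d0 := normr_ge0 (r - r').
move: (rI) (r'I); rewrite !in_itv/= => /andP[r0 r1] /andP[r'0 r'1].
have rs : 0 <= r * s by rewrite mulr_ge0.
have rs' : 0 <= r' * s by rewrite mulr_ge0.
have drs : `|r * s - r' * s| = s * `|r - r'|.
  by rewrite -mulrBl normrM (ger0_norm s0) mulrC.
have Kss : 0 <= K * s by rewrite mulr_ge0.
have Kd : 0 <= K * s * `|r - r'| by rewrite mulr_ge0.
split=> [|u u' uI u'I].
  have -> : len (G r) + r * s - (len (G r') + r' * s) =
    len (G r) - len (G r') + (r * s - r' * s) by ring.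
  apply: le_trans (ler_normD _ _) _; rewrite drs; nra.
have e0 := normr_ge0 (u - u').
have := hold_lipschitz t u u' rs rs'; rewrite drs.
have := subr_hold_itv t u' rs'.
have := hold_itv rs tr uI; have := hold_itv rs' tr' u'I.
set h := hold t (r * s) u; set h' := hold t (r' * s) u' => h'I hI u'h' hh'.
have [posK velK] := GrK h h' hI h'I.
have hK : K * (`|r - r'| + `|h - h'|) <= K * (`|r - r'| + (s * `|r - r'| + `|u - u'|)).
  by rewrite ler_wpM2l// lerD2l.
have Ke : 0 <= K * s * `|u - u'| by rewrite mulr_ge0.
have sd : 0 <= s * `|r - r'| by rewrite mulr_ge0.
have se : 0 <= s * `|u - u'| by rewrite mulr_ge0.
split; last by apply: (le_trans velK); apply: (le_trans hK); nra.
have [_ velt] := GrK t t tr tr'; rewrite subrr normr0 addr0 in velt.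
have unitt : enorm (vel (G r) t) = 1 by case: bGr => _ _ _ + _; apply.
rewrite /= -/h -/h'.
have -> : pos (G r) h + (u - h) *: vel (G r) t -
    (pos (G r') h' + (u' - h') *: vel (G r') t) =
    (pos (G r) h - pos (G r') h') + (((u - h) - (u' - h')) *: vel (G r) t +
    (u' - h') *: (vel (G r) t - vel (G r') t)).
  rewrite opprD addrACA; congr (_ + _).
  by rewrite [in RHS]scalerBl [in RHS]scalerBr addrA subrK.
apply: le_trans (ler_enormD _ _) _.
have := ler_enormD (((u - h) - (u' - h')) *: vel (G r) t)
  ((u' - h') *: (vel (G r) t - vel (G r') t)).
rewrite !enormZ unitt mulr1.
have uh : `|u - h - (u' - h')| <= `|u - u'| + `|h - h'|.
  rewrite (_ : _ - _ = (u - u') - (h - h')); last by ring.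
  exact: ler_normB.
have u's : `|u' - h'| * enorm (vel (G r) t - vel (G r') t) <= s * (K * `|r - r'|).
  apply: ler_pM; rewrite ?enorm_ge0//.
  by move: u'h' => /andP[? ?]; rewrite ger0_norm//; nra.
nra.
Qed.

Lemma lipschitz_family_C1_continuous G : lipschitz_family G ->
  (forall r, r \in `[0, 1] -> bounded_curvature (G r)) -> C1_continuous G.
Proof.
move=> [K K0 GK] bG; apply/C1_continuousP => t tI e e0.
have I0 : (0 : R) \in `[0, 1] by rewrite in_itv/= lexx ler01.
have [L0 _ _ _ _] := bG 0 I0.
(* [M] bounds all lengths in the family; [C] is a Lipschitz constant for [C1_dist], with
   [K * (1 + K)] for the positions and the rest for the scaled velocities. *)
pose M := len (G 0) + K; have M0 : 0 <= M by rewrite addr_ge0.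
pose C := K * (1 + K) + (K + M * (K * (1 + K))).
have C0 : 0 <= C by rewrite !(addr_ge0, mulr_ge0).
exists (e / (C + 1)); first by rewrite divr_gt0// ltr_wpDl.
move=> u uI ut; rewrite ger0_norm; last by rewrite addr_ge0 ?sup_dist_ge0.
apply: (@le_lt_trans _ _ (C * `|t - u|)); last first.
  move: ut; rewrite distrC ltr_pdivlMr ?ltr_wpDl//; apply: le_lt_trans.
  by rewrite mulrC ler_wpM2l// lerDl.
have [lenK GtK] := GK t u tI uI; have d0 := normr_ge0 (t - u).
have [Lt0 _ _ unitt _] := bG t tI; have [Lu0 _ _ _ _] := bG u uI.
have LuM : len (G u) <= M.
  have [+ _] := GK u 0 uI I0; rewrite subr0 => /(le_trans (ler_norm _)).
  move: uI; rewrite in_itv/= => /andP[u0 u1].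
  rewrite ger0_norm// /M => h; nra.
have scaleI (l r : R) : 0 <= l -> r \in `[0, 1] -> l * r \in `[0, l].
  by move=> l0; rewrite !in_itv/= => /andP[? ?]; rewrite mulr_ge0// ler_piMr.
have dist r : r \in `[0, 1] ->
    K * (`|t - u| + `|len (G t) * r - len (G u) * r|) <= K * (1 + K) * `|t - u|.
  rewrite in_itv/= => /andP[r0 r1].
  rewrite -mulrA ler_wpM2l// mulrDl mul1r lerD2l -mulrBl normrM (ger0_norm r0).
  by apply: le_trans lenK; rewrite ler_piMr.
rewrite /C mulrDl lerD//; apply: sup_dist_le => r rI.
  have [posK _] := GtK _ _ (scaleI _ _ Lt0 rI) (scaleI _ _ Lu0 rI).
  by apply: le_trans posK _; exact: dist.
have [_ velK] := GtK _ _ (scaleI _ _ Lt0 rI) (scaleI _ _ Lu0 rI).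
have -> : len (G t) *: vel (G t) (len (G t) * r) -
    len (G u) *: vel (G u) (len (G u) * r) =
    (len (G t) - len (G u)) *: vel (G t) (len (G t) * r) +
    len (G u) *: (vel (G t) (len (G t) * r) - vel (G u) (len (G u) * r)).
  by rewrite scalerBl scalerBr addrA subrK.
apply: le_trans (ler_enormD _ _) _; rewrite !enormZ unitt ?scaleI// mulr1 mulrDl.
apply: lerD => //; rewrite -mulrA; apply: ler_pM; rewrite ?enorm_ge0//.
  by rewrite ger0_norm.
by apply: le_trans velK _; exact: dist.
Qed.

Lemma insert_segment_start g t s : 0 <= t ->
  pos (insert_segment g t s) 0 = pos g 0 /\ vel (insert_segment g t s) 0 = vel g 0.
Proof. by move=> t0 /=; rewrite hold_before// subrr scale0r addr0. Qed.

Lemma insert_segment_end g t s : 0 <= s -> t <= len g ->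
  let h := insert_segment g t s in
  pos h (len h) = pos g (len g) + s *: vel g t /\ vel h (len h) = vel g (len g).
Proof.
by move=> s0 tL /=; rewrite hold_after ?lerD2r// addrK addrAC subrr add0r.
Qed.

(** The segment at [t'] goes in first: for [t <= t'] it leaves the path up to time [t] unchanged, so
    [t] keeps its meaning. *)
Definition stretch g t t' s : plane_path R :=
  insert_segment (insert_segment g t' s) t s.

(* The two inserted segments have opposite directions and the same length, so the
   endpoint does not move. *)
Lemma stretch_Gamma x y g t t' s : Gamma x y g -> 0 <= t -> t <= t' ->
  t' <= len g -> vel g t' = - vel g t -> 0 <= s -> Gamma x y (stretch g t t' s).
Proof.
move=> /GammaP[bg [p0 v0 pL vL]] t0 tt' t'L vt' s0.
have t'0 := le_trans t0 tt'; have tL := le_trans tt' t'L.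
apply/GammaP; split.
  apply: insert_segment_bounded_curvature => //.
    by apply: insert_segment_bounded_curvature => //; rewrite in_itv/= t'0.
  by rewrite in_itv/= t0 ler_wpDr.
have [q0 w0] := insert_segment_start g s t'0.
have [r0 z0] := insert_segment_start (insert_segment g t' s) s t0.
have [qL wL] := insert_segment_end s0 t'L.
have [|rL zL] := @insert_segment_end (insert_segment g t' s) t s s0.
  by rewrite /= ler_wpDr.
rewrite /stretch r0 z0 rL zL q0 w0 qL wL; split => //.
by rewrite /= hold_before// vt' scalerN subrK.
Qed.

(** Both segments grow together from length 0 to length [s]. *)
Lemma stretch_joined x y g t t' s : Gamma x y g -> 0 <= t -> t <= t' ->
  t' <= len g -> vel g t' = - vel g t -> 0 <= s ->
  joined (Gamma x y) g (stretch g t t' s).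
Proof.
move=> Gg t0 tt' t'L vt' s0; exists (fun r => stretch g t t' (r * s)).
have GG r : r \in `[0, 1] -> Gamma x y (stretch g t t' (r * s)).
  by rewrite in_itv/= => /andP[r0 _]; apply: stretch_Gamma; rewrite ?mulr_ge0.
have bG r : r \in `[0, 1] -> bounded_curvature (insert_segment g t' (r * s)).
  rewrite in_itv/= => /andP[r0 _].
  apply: insert_segment_bounded_curvature; rewrite ?mulr_ge0//.
    by case/GammaP: Gg.
  by rewrite in_itv/= t'L (le_trans t0).
split => //.
- apply: lipschitz_family_C1_continuous; last first.
    by move=> r /GG /GammaP[].
  apply: lipschitz_family_insert => //.
    apply: lipschitz_family_insert => //.
      by apply: lipschitz_family_cst; case/GammaP: Gg.
    by move=> r _; split; [case/GammaP: Gg|rewrite in_itv/= t'L (le_trans t0)].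
  move=> r rI; split; first exact: bG.
  move: rI; rewrite !in_itv/= => /andP[r0 _].
  by rewrite t0 (le_trans (le_trans tt' t'L))// lerDl mulr_ge0.
- by rewrite mul0r /stretch !insert_segment0.
- by rewrite mul1r.
Qed.

End families.

(** * Loops and endpoints *)

Section conclusion.
Variable R : realType.
Implicit Types (g : plane_path R) (x y : UT R) (s t : R).

Lemma unit_vec_Dpi t : unit_vec (t + pi) = - unit_vec t.
Proof. by rewrite /unit_vec cosDpi sinDpi. Qed.

(* By Rolle's theorem applied to the coordinates of the position, every direction
   or its opposite is a velocity; a set of directions that is closed and meets
   each antipodal pair exactly once would disconnect the circle. *)
Lemma loop_antipodal g : bounded_curvature g -> 0 < len g ->
  pos g 0 = pos g (len g) ->
  exists t t', [/\ 0 <= t, t <= t', t' <= len g & vel g t' = - vel g t].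
Proof.
move=> [_ C1 _ unit _] L0 loop.
suff [u [u' [uI u'I uu']]] : exists u u',
    [/\ u \in `[0, len g], u' \in `[0, len g] & vel g u' = - vel g u].
  move: uI u'I; rewrite !in_itv/= => /andP[? ?] /andP[? ?].
  have [le|/ltW le] := leP u u'; first by exists u, u'.
  by exists u', u; split => //; rewrite uu' opprK.
pose A := vel g @` `[0, len g].
have clA : closed A.
  apply: compact_closed; first exact: norm_hausdorff.
  by apply: continuous_compact; [case: C1|exact: segment_compact].
(* Directions are lifted to angles, so that the connectedness of the real line can be used. *)
pose E := [set t | A (unit_vec t)]; pose E' := [set t | A (- unit_vec t)].
have clE : closed E.
  by apply: (preimage_closed _ clA) => t _; exact: unit_vec_continuous.
have clE' : closed E'.
  apply: (@preimage_closed _ _ (fun t => - unit_vec t) _ _ clA) => t _.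
  by apply: cvgN; exact: unit_vec_continuous.
have cover t : E t \/ E' t.
  (* The coordinate normal to [unit_vec t] has a critical point, where the velocity is parallel to
     [unit_vec t]. *)
  have [|||u uI du] := @Rolle _ (fun u => dot (- sin t, cos t) (pos g u)) _ _ L0.
  - by move=> u uI; case: (is_derive_dot (- sin t, cos t) (C1_pos_derive C1 uI)).
  - exact/within_dot/C1_pos_continuous.
  - by rewrite loop.
  have uI' := subset_itv_oo_cc uI.
  have nv : dot (- sin t, cos t) (vel g u) = 0.
    case: (is_derive_dot (- sin t, cos t) (C1_pos_derive C1 uI)) => _ <-.
    by case: du.
  have [vu|vu] := unit_vec_orthogonal (unit u uI') nv.
    by left; exists u.
  by right; exists u.
have Epi t : E' t -> E (t + pi) by rewrite /E /E' /= unit_vec_Dpi.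
have Epi' t : E t -> E' (t + pi) by rewrite /E /E' /= unit_vec_Dpi opprK.
suff [t [[u uI ut] [u' u'I ut']]] : exists t, E t /\ E' t.
  by exists u, u'; split => //; rewrite ut ut'.
apply: contrapT => disj.
have EE' : E = ~` E'.
  apply/seteqP; split=> [t Et E't|t nE't]; first by apply: disj; exists t.
  by have [] := cover t.
have conn : connected [set: R] by apply/connected_intervalP.
(* [E] is nonempty, closed, and open as the complement of [E']. Being everything, it contains [0],
   which puts [pi] in [E'] as well. *)
have ET : E = [set: R].
  apply: conn.
  - by have [?|/Epi ?] := cover 0; [exists 0|exists (0 + pi)].
  - by exists E => //; [rewrite EE'; exact: closed_openC|rewrite setTI].
  - by exists E => //; rewrite setTI.
apply: disj; exists (0 + pi); split; first by rewrite ET.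
by apply: Epi'; rewrite ET.
Qed.

Lemma stretch_in_class x y g t t' (D : set (plane_path R)) :
  homotopy_class x y D -> D g -> 0 <= t -> t <= t' -> t' <= len g ->
  vel g t' = - vel g t -> forall s, 0 <= s -> D (stretch g t t' s).
Proof.
move=> HD Dg t0 tt' t'L vt' s s0; apply: (homotopy_class_joined HD Dg).
by apply: stretch_joined => //; case: HD => DG _ _; exact: DG.
Qed.

(** Covers both curves of endpoints that are used: the rotating tangent at the origin and
    [arc_end]. *)
Definition with_direction (f : R -> R * R) t : UT R :=
  (f t, exist _ (unit_vec t) (circle_unit_vec t)).

Lemma with_direction_continuous (f : R -> R * R) :
  continuous f -> continuous (with_direction f).
Proof.
move=> cf t.
pose e t : set_type (@circle R) := exist _ (unit_vec t) (circle_unit_vec t).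
have ce : continuous e.
  apply: (@continuous_comp_initial _ _ _ (@set_val _ (@circle R))).
  exact: unit_vec_continuous.
by apply: (@cvg_pair _ _ _ _ (nbhs (f t)) (nbhs (e t))); [exact: cf|exact: ce].
Qed.

Lemma not_open_bounded_class_endpoints : ~ open (@bounded_class_endpoints R).
Proof.
move=> oB; pose loop := with_direction (fun=> (0, 0)).
have cl : continuous loop by apply: with_direction_continuous => t; exact: cvg_cst.
have B0 : bounded_class_endpoints (loop 0).
  have := arc_end_bounded_class (lexx 0) (pi_gt0 R); congr bounded_class_endpoints.
  by rewrite /arc_end /loop /with_direction sin0 cos0 subrr.
have : nbhs 0 (loop @^-1` @bounded_class_endpoints R).
  by apply: open_nbhs_nbhs; split => //; apply: open_comp => // t _; exact: cl.
move=> /nbhs_ballP[d/= d0 dB].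
have m0 : 0 < Num.min d pi by rewrite lt_min d0 pi_gt0.
pose t := Num.min d pi / 2.
have t0 : 0 < t by rewrite divr_gt0.
have : t < Num.min d pi by rewrite /t; lra.
rewrite lt_min => /andP[td tpi].
have : bounded_class_endpoints (loop t).
  by apply: dB; rewrite /ball/= sub0r normrN gtr0_norm.
move=> [D [[g Dg] HD]].
have /GammaP[bg [p0 v0 pL vL]] : Gamma (origin_right R) (loop t) g.
  by case: HD => DG _ _; exact: DG.
have [L0 _ _ _ _] := bg.
have Lgt0 : 0 < len g.
  (* Length 0 would force [unit_vec t = (1, 0)], but [sin t > 0] for [t] between 0 and [pi]. *)
  rewrite lt_neqAle L0 andbT; apply/eqP => L00.
  move: vL; rewrite -L00 v0 => -[_ s0].
  by have := @sin_gt0_pi _ t; rewrite -s0 ltxx t0 tpi => /(_ isT).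
have ploop : pos g 0 = pos g (len g) by rewrite p0 pL.
have I0 : 0 \in `[0, len g] by rewrite in_itv/= lexx.
have IL : len g \in `[0, len g] by rewrite in_itv/= lexx L0.
case=> [[emb _]|single].
  by have := emb g Dg _ _ I0 IL ploop => L00; rewrite -L00 ltxx in Lgt0.
have [u [u' [u0 uu' u'L vu]]] := loop_antipodal bg Lgt0 ploop.
(* The stretched path is longer by 2. *)
have [] := single _ _ Dg (stretch_in_class HD Dg u0 uu' u'L vu ler01).
by move=> /= h _; lra.
Qed.

Lemma not_closed_bounded_class_endpoints : ~ closed (@bounded_class_endpoints R).
Proof.
move=> cB.
have ca : continuous (@arc_end R).
  apply: with_direction_continuous => t.
  apply: (@cvg_pair _ _ _ _ (nbhs (sin t)) (nbhs (1 - cos t))).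
    exact: continuous_sin.
  by apply: cvgB; [exact: cvg_cst|exact: continuous_cos].
have cP : closed (@arc_end R @^-1` @bounded_class_endpoints R).
  by apply: (preimage_closed _ cB) => t _; exact: ca.
(* The preimage under [arc_end] would be closed, and it contains every [t] with [0 <= t < pi]. *)
have : bounded_class_endpoints (arc_end (pi : R)).
  apply: cP => U /nbhs_ballP[d/= d0 dU].
  have pi0 := pi_gt0 R.
  have m0 : 0 < Num.min d pi by rewrite lt_min d0.
  pose r := Num.min d pi / 2.
  have r0 : 0 < r by rewrite divr_gt0.
  have : r < Num.min d pi by rewrite /r; lra.
  rewrite lt_min => /andP[rd rpi].
  exists (pi - r); split; first by apply: arc_end_bounded_class; lra.
  by apply: dU; rewrite /ball/= subKr gtr0_norm.
move=> [D [[g Dg] HD]].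
have /GammaP[bg [p0 v0 pL vL]] : Gamma (origin_right R) (arc_end pi) g.
  by case: HD => DG _ _; exact: DG.
have [L0 _ _ _ _] := bg.
have vv : vel g (len g) = - vel g 0.
  have -> : vel g (len g) = unit_vec pi by [].
  have -> : vel g 0 = (1, 0) by [].
  by rewrite /unit_vec cospi sinpi; congr pair; rewrite /= oppr0.
have DS s : 0 <= s -> D (stretch g 0 (len g) s).
  exact: (stretch_in_class HD Dg (lexx 0) L0 (lexx _) vv).
case=> [[_ [W bW DW]]|single]; last first.
  by have [] := single _ _ Dg (DS 1 ler01) => /= h _; clear -h; lra.
have [M [_ MO]] := bW.
(* Every number above [M] bounds the region; [N] is such a bound and [K] exceeds it. *)
pose N := `|M| + 1; pose K := N + 1.
have N0 : 0 <= N by rewrite addr_ge0.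
have K0 : 0 <= K by rewrite addr_ge0.
have KI : K \in `[0, len (stretch g 0 (len g) K)].
  by rewrite in_itv/= K0 /=; lra.
have MN : M < N by rewrite /N; have := ler_norm M; lra.
(* The stretched path begins with a straight segment of length [K] from the origin in direction
   [(1, 0)]. *)
have posK : pos (stretch g 0 (len g) K) K = (K, 0).
  have hK : hold 0 K K = 0 by rewrite hold_during ?add0r.
  rewrite /stretch /insert_segment/= hK (hold_before _ L0) p0 v0.
  have -> : tangent (origin_right R) = (1, 0) by [].
  have -> : base_point (origin_right R) = 0 by [].
  rewrite !subr0 scale0r addr0 add0r; congr pair; rewrite /= /GRing.scale/=.
    by rewrite mulr1.
  by rewrite mulr0.
have KN : `|(K, 0 : R)| <= N.
  by rewrite -posK; exact: (MO _ MN _ (DW _ (DS K K0) K KI)).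
have : K <= N.
  by apply: le_trans KN; rewrite prod_normE le_max ger0_norm// lexx.
by rewrite leNgt /K ltrDl ltr01.
Qed.

End conclusion.

Theorem corollary8p7 (R : realType) :
  ~ open (@bounded_class_endpoints R) /\ ~ closed (@bounded_class_endpoints R).
Proof.
split; first exact: not_open_bounded_class_endpoints.
exact: not_closed_bounded_class_endpoints.
Qed.
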